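(* Let $(X,d)$ be a complete metric space with a doubling measure $\mu$, and let $E\subset X$ be nonempty. Assume that $E$ is weakly porous and $h_E$ is doubling. Let $\alpha\in\mathbb{R}$ and define $w(x)=\operatorname{dist}(x,E)^{-\alpha}$ for every $x\in X$. Then (i) $w\in A_1(X)$ if and only if $0\le\alpha<\operatorname{Mu}(E)$. (ii) For $1<p<\infty$, $w\in A_p(X)$ if and only if $(1-p)\operatorname{Mu}(E)<\alpha<\operatorname{Mu}(E)$.
   Context: Setting: $(X,d)$ is a complete metric space, $B(x,r)=\{y\in X: d(x,y)<r\}$, and $\mu$ is a complete Borel regular measure on $X$ with a constant $C_\mu>0$ such that $0<\mu(B(x,2r))\le C_\mu\,\mu(B(x,r))<\infty$ for all $x\in X$, $r>0$. Balls are open and come with a prescribed center and radius. $\operatorname{dist}(x,E)=\inf\{d(x,y):y\in E\}$, and for $\alpha>0$, $\operatorname{dist}(x,E)^{-\alpha}=+\infty$ when $\operatorname{dist}(x,E)=0$. For $r>0$, $E_r=\{y\in X:\operatorname{dist}(y,E)<r\}$. Maximal $E$-free hole: for a ball $B=B(x,R)$, $h_E(B)=\sup\{0<r\le 2R:\ \text{there exists } y\in X \text{ with } B(y,r)\subset B(x,R)\setminus E\}$, with $h_E(B)=0$ if there is no such $r$. $h_E$ is doubling if there is $C>0$ with $h_E(B(x,2R))\le C\,h_E(B(x,R))$ for all $x\in X$, $R>0$. $E$ is weakly porous if there are constants $c,\delta\in(0,1)$ such that for every ball $B=B(x,R)\subset X$ there is a finite collection of mutually disjoint open balls $B_i=B(x_i,r_i)$,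 $i=1,\dots,N$, contained in $B\setminus E$, with $\delta h_E(B)\le r_i\le 2R$ for every $i$ and $\sum_{i=1}^N\mu(B_i)\ge c\,\mu(B)$. Muckenhoupt exponent: if $h_E(B(x,R))>0$ for every $x\in E$ and $R>0$, then $\operatorname{Mu}(E)$ is the supremum of the numbers $\alpha\in\mathbb{R}$ for which there exists a constant $C$ such that $$\frac{\mu(E_r\cap B(x,R))}{\mu(B(x,R))}\le C\left(\frac{h_E(B(x,R))}{r}\right)^{-\alpha}$$ for every $x\in E$ and $0<r<h_E(B(x,R))\le 2R$. If $h_E(B(x,R))=0$ for some $x\in E$ and $R>0$, then $\operatorname{Mu}(E)=0$. A weight is a nonnegative locally integrable function $w$ on $X$. $w\in A_1(X)$ if there is $C\ge0$ with $\frac1{\mu(B)}\int_B w\,d\mu\le C\operatorname{ess\,inf}_B w$ for every ball $B\subset X$. For $1<p<\infty$, $w\in A_p(X)$ if $\sup_B\left(\frac1{\mu(B)}\int_B w\,d\mu\right)\left(\frac1{\mu(B)}\int_B w^{\frac1{1-p}}\,d\mu\right)^{p-1}<\infty$, the supremum being over all balls $B\subset X$. *)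

(* Defs.v *)
From HB Require Import structures.
From mathcomp Require Import all_boot all_order all_algebra.
From mathcomp Require Import all_classical all_reals all_analysis ess_sup_inf.

Set Implicit Arguments.
Unset Strict Implicit.
Unset Printing Implicit Defensive.

Import Order.TTheory GRing.Theory Num.Theory.
Import numFieldNormedType.Exports.

Local Open Scope classical_set_scope.
Local Open Scope ring_scope.

#[short(type="completeMetricType")]
HB.structure Definition CompleteMetric (R : numDomainType) :=
  {T of CompletePseudoMetric R T & Metric R T}.

(* The sigma-algebra is not tied to the topology here: it may be larger than
   the Borel one. The link is [borel_regular] below. *)
#[short(type="completeMetricMeasurableType")]
HB.structure Definition CompleteMetricMeasurable (R : numDomainType)
    (d : measure_display) :=
  {T of CompleteMetric R T & Measurable d T}.

Section weak_porosity.
Context {R : realType} {d : measure_display}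
        {X : completeMetricMeasurableType R d}.
Implicit Types (mu : {measure set X -> \bar R}) (E : set X) (w : X -> \bar R).

Definition borel : set (set X) := <<s [set U : set X | open U] >>.

Definition borel_regular mu :=
  borel `<=` measurable /\
  forall A : set X, measurable A ->
    exists B, [/\ borel B, A `<=` B & mu B = mu A].

Definition doubling_measure mu := exists2 C : R, 0 < C &
  forall (x : X) (r : R), 0 < r ->
    [/\ (0 < mu (ball x (2 * r)))%E,
        (mu (ball x (2 * r)) <= C%:E * mu (ball x r))%E &
        (C%:E * mu (ball x r) < +oo)%E].

Definition set_dist (x : X) E : R := inf [set mdist x y | y in E].

Definition set_nbhd E (r : R) : set X := [set y | set_dist y E < r].

(* [sup] of the empty set is 0, as required when there is no hole; the set is
   bounded above by [2 * r]. *)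
Definition hole E (x : X) (r : R) : R :=
  sup [set s : R | 0 < s <= 2 * r /\
                   exists y : X, ball y s `<=` ball x r `\` E].

Definition doubling_hole E := exists2 C : R, 0 < C &
  forall (x : X) (r : R), 0 < r -> hole E x (2 * r) <= C * hole E x r.

Definition weakly_porous mu E := exists c delta : R,
  [/\ 0 < c < 1, 0 < delta < 1 &
   forall (x : X) (r : R), 0 < r ->
     exists (N : nat) (y : 'I_N -> X) (s : 'I_N -> R),
     [/\ forall i, 0 < s i /\ ball (y i) (s i) `<=` ball x r `\` E,
         trivIset [set: 'I_N] (fun i => ball (y i) (s i)),
         forall i, delta * hole E x r <= s i <= 2 * r &
         (c%:E * mu (ball x r) <= \sum_(i < N) mu (ball (y i) (s i)))%E]].

Definition muckenhoupt_admissible mu E (alpha : R) := exists C : R,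
  forall (x : X) (r s : R), E x -> 0 < r ->
    0 < s -> s < hole E x r -> hole E x r <= 2 * r ->
    (mu (set_nbhd E s `&` ball x r) / mu (ball x r) <=
     (C * (hole E x r / s) `^ (- alpha))%:E)%E.

Definition Mu mu E : \bar R :=
  if `[< forall (x : X) (r : R), E x -> 0 < r -> 0 < hole E x r >]
  then ereal_sup [set alpha%:E | alpha in muckenhoupt_admissible mu E]
  else 0%E.

(* Real powers on [0, +oo] with 0^a = +oo and (+oo)^a = 0 for a < 0, and
   0^0 = 1. The library's [poweR] cannot be used directly for negative
   exponents, since it sends 0 to 0 and +oo to +oo. *)
Definition epow (x : \bar R) (a : R) : \bar R :=
  if a < 0 then ((x `^ (- a)%R)^-1)%E else (x `^ a)%E.

Lemma epow_EFin (x a : R) : 0 < x -> epow x%:E a = (x `^ a)%:E.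
Proof.
move=> x0; rewrite /epow; case: ifPn => _ //.
rewrite poweR_EFin inver gt_eqF ?powR_gt0//.
by rewrite powRN invrK.
Qed.

Lemma epow0N (a : R) : a < 0 -> epow 0%E a = +oo%E.
Proof.
move=> a0; rewrite /epow a0 poweR0r ?inve0//.
by rewrite oppr_eq0 lt_eqF.
Qed.

Lemma epowyN (a : R) : a < 0 -> epow +oo%E a = 0%E.
Proof.
move=> a0; rewrite /epow a0 poweRyr ?invey//.
by rewrite oppr_eq0 lt_eqF.
Qed.

Definition dist_weight E (alpha : R) : X -> \bar R :=
  fun x => epow (set_dist x E)%:E (- alpha).

(* Local integrability is integrability on balls; X being complete and mu
   doubling, closed balls are compact, so this agrees with integrability near
   every point and on compact sets. Weights may take the value +oo. *)
Definition weight mu w :=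
  (forall x, (0 <= w x)%E) /\
  (forall (x : X) (r : R), 0 < r -> mu.-integrable (ball x r) w).

Definition average mu w (B : set X) : \bar R :=
  ((mu B)^-1 * \int[mu]_(y in B) w y)%E.

(* Extending w by +oo outside B makes the global essential infimum that of
   w over B. *)
Definition ess_inf_on mu w (B : set X) : \bar R :=
  ess_inf mu (patch (cst +oo%E) B w).

Definition A1 mu w := weight mu w /\
  exists2 C : R, 0 <= C & forall (x : X) (r : R), 0 < r ->
    (average mu w (ball x r) <= C%:E * ess_inf_on mu w (ball x r))%E.

Definition Ap mu (p : R) w := weight mu w /\
  (ereal_sup [set average mu w (ball xr.1 xr.2) *
     (average mu (fun y => epow (w y) (1 / (1 - p))%R) (ball xr.1 xr.2))
       `^ (p - 1)%R
     | xr in [set xr : X * R | (0 < xr.2)%R]] < +oo)%E.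

End weak_porosity.

(* Main.v *)
Require Import Defs.
From HB Require Import structures.
From mathcomp Require Import all_boot all_order all_algebra.
From mathcomp Require Import all_classical all_reals all_analysis ess_sup_inf measurable_realfun.
From mathcomp Require Import ring lra.

(* Everything rests on one estimate. Call a >= 0 good if the average of
   dist(., E)^(-a) over every ball B is at most K h_E(B)^(-a). Since E is weakly
   porous, every ball B contains a proportional part at distance at least
   t h_E(B) from E; this gives lower bounds for averages of positive powers of
   the distance and upper bounds for the essential infimum, so either of the A_1
   and A_p conditions makes the relevant exponent good.

   A good exponent improves itself. At a scale u choose around each y near E a
   radius where h_E(B(y, .)) is about u; by doubling of h_E these radii exist and
   vary slowly, so a maximal disjoint family of small balls covers after a bounded
   enlargement. The far parts of the small balls lie in a layer
   {eps u <= dist < 3 D u}, and goodness shows that this layer carries a fixed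
   proportion of the dist^(-a) mass of {dist < eps u}. Iterating over geometric
   scales, the mass of {dist < s} in B decays like a power of s / h_E(B), and
   Chebyshev's inequality makes a + eta admissible in the definition of Mu(E),
   whence a < Mu(E) strictly. The trivially good a = 0 gives Mu(E) > 0.

   Conversely, if 0 <= a < Mu(E), summing over dyadic layers bounds the average
   of dist^(-a) over B by C m^(-a), where m bounds dist(., E) on B; A_1 and, with
   the dual weight dist^(-a/(1-p)), A_p follow. *)

Set Implicit Arguments.
Unset Strict Implicit.
Unset Printing Implicit Defensive.

Import Order.TTheory GRing.Theory Num.Theory.
Import numFieldNormedType.Exports.
Local Open Scope classical_set_scope.
Local Open Scope ring_scope.

(** * Distance to a set, its level sets, and inclusions of balls *)

Section distance_to_a_set.
Context {R : realType} {d : measure_display}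
  {X : completeMetricMeasurableType R d}.
Implicit Types (x y z : X) (r s a : R) (A E : set X).

Lemma set_dist_ge0 x E : 0 <= set_dist x E.
Proof.
have [->|/set0P[e Ee]] := eqVneq E set0.
  by rewrite /set_dist image_set0 inf0.
apply: lb_le_inf; first by exists (mdist x e), e.
by move=> _ [y _ <-]; exact: mdist_ge0.
Qed.

Lemma set_dist_le x y E : E y -> set_dist x E <= mdist x y.
Proof.
move=> Ey; apply: ge_inf; last by exists y.
by exists 0 => _ [z _ <-]; exact: mdist_ge0.
Qed.

Lemma le_set_dist x E r : E !=set0 -> (forall y, E y -> r <= mdist x y) ->
  r <= set_dist x E.
Proof.
move=> [e Ee] rE; apply: lb_le_inf; first by exists (mdist x e), e.
by move=> _ [y Ey <-]; exact: rE.
Qed.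

Lemma set_dist_lt x E r : E !=set0 -> set_dist x E < r ->
  exists2 y, E y & mdist x y < r.
Proof.
move=> E0 xr; apply: contrapT => nE; move: xr; apply/negP; rewrite -leNgt.
by apply: le_set_dist => // y Ey; rewrite leNgt; apply/negP => yr; apply: nE; exists y.
Qed.

Lemma set_dist_lip x y E : E !=set0 -> set_dist x E <= set_dist y E + mdist x y.
Proof.
move=> E0; rewrite -lerBlDr; apply: le_set_dist => // z Ez; rewrite lerBlDr.
by rewrite (le_trans (set_dist_le x Ez))// addrC metric_triangle.
Qed.

Lemma ball_le_set_dist x r E : E !=set0 -> ball x r `<=` ~` E ->
  r <= set_dist x E.
Proof.
move=> E0 rE; apply: le_set_dist => // y Ey; rewrite leNgt; apply/negP => xy.
by apply: (rE y) => //; rewrite ballEmdist.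
Qed.

Lemma ball_set_dist x r E : r <= set_dist x E -> ball x r `<=` ~` E.
Proof.
move=> rE y; rewrite ballEmdist/= => xy Ey.
by have := le_lt_trans rE (le_lt_trans (set_dist_le x Ey) xy); rewrite ltxx.
Qed.

Lemma subset_ball_triangle x y r s : mdist x y + r <= s -> ball y r `<=` ball x s.
Proof.
move=> xyrs z; rewrite !ballEmdist/= => yz.
by rewrite (le_lt_trans (metric_triangle x y z))// (lt_le_trans _ xyrs)// ltrD2l.
Qed.

Lemma mem_ball_center x r : 0 < r -> ball x r x.
Proof. by move=> r0; rewrite ballEmdist/= mdistxx. Qed.

Lemma open_metricP A : (forall x, A x -> exists2 r, 0 < r & ball x r `<=` A) ->
  open A.
Proof.
by move=> oA; rewrite openE => x /oA[r r0 rA]; apply/nbhs_ballP; exists r.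
Qed.

Lemma metric_ball_open x r : open (ball x r).
Proof.
apply: open_metricP => y xy; exists (r - mdist x y).
  by move: xy; rewrite ballEmdist/= subr_gt0.
by apply: subset_ball_triangle; rewrite addrC subrK.
Qed.

Lemma open_set_nbhd E r : E !=set0 -> open (set_nbhd E r).
Proof.
move=> E0; apply: open_metricP => y yE; exists (r - set_dist y E).
  by rewrite subr_gt0.
move=> z; rewrite ballEmdist/= => yz.
rewrite /set_nbhd/= (le_lt_trans (set_dist_lip z y E0))//.
by rewrite metric_sym -ltrBrDl.
Qed.

Lemma open_set_dist_gt E r : E !=set0 -> open [set x | r < set_dist x E].
Proof.
move=> E0; apply: open_metricP => y yE; exists (set_dist y E - r).
  by rewrite subr_gt0.
move=> z; rewrite ballEmdist/= => yz.
by have := set_dist_lip y z E0; lra.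
Qed.

End distance_to_a_set.

(** * Maximal holes: bounds and monotonicity *)

Section hole.
Context {R : realType} {d : measure_display}
  {X : completeMetricMeasurableType R d} (E : set X).
Implicit Types (x y z : X) (r s a : R).

Lemma le_hole x r y s : 0 < s <= 2 * r -> ball y s `<=` ball x r `\` E ->
  s <= hole E x r.
Proof.
move=> s02 sub; apply: ub_le_sup; last by split => //; exists y.
by exists (2 * r) => t [/andP[]].
Qed.

Lemma hole_le x r b : 0 <= b ->
  (forall y s, 0 < s <= 2 * r -> ball y s `<=` ball x r `\` E -> s <= b) ->
  hole E x r <= b.
Proof.
move=> b0 sb; rewrite /hole; set A := [set _ | _].
have [->|/set0P A0] := eqVneq A set0; first by rewrite sup0.
by apply: ge_sup => // s [s02 [y ys]]; exact: sb ys.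
Qed.

Lemma hole_ge0 x r : 0 <= hole E x r.
Proof.
rewrite /hole; set A := [set _ | _].
have [->|/set0P[s As]] := eqVneq A set0; first by rewrite sup0.
have [/andP[s0 s2] [y ys]] := As.
by rewrite (le_trans (ltW s0))// (le_hole _ ys)// s0.
Qed.

Lemma hole_le2r x r : 0 <= r -> hole E x r <= 2 * r.
Proof. by move=> r0; apply: hole_le => [|y s /andP[]//]; rewrite mulr_ge0. Qed.

Lemma hole_mono x y r s : r <= s -> ball x r `<=` ball y s ->
  hole E x r <= hole E y s.
Proof.
move=> rs sub; apply: hole_le => [|z t /andP[t0 tr] zt]; first exact: hole_ge0.
apply: (@le_hole _ _ z); last by move=> w /zt[/sub].
by rewrite t0 (le_trans tr)// ler_pM2l.
Qed.

End hole.

(** * Measures given by a density *)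

Section density_measure.
Context d (T : measurableType d) (R : realType)
  (mu : {measure set T -> \bar R}) (f : T -> \bar R)
  (mf : measurable_fun [set: T] f) (f0 : forall x, (0 <= f x)%E).

(** The two proofs are arguments so that the measure structure, which depends on them, can be
    attached to this constant. *)
Definition density_measure of measurable_fun [set: T] f &
    (forall x, (0 <= f x)%E) := fun A : set T => (\int[mu]_(x in A) f x)%E.

Local Notation nu := (density_measure mf f0).

Let nu0 : nu set0 = 0%E. Proof. exact: integral_set0. Qed.

Let nu_ge0 A : (0 <= nu A)%E.
Proof. by apply: integral_ge0 => x _; exact: f0. Qed.

Let nu_sigma_additive : semi_sigma_additive nu.
Proof.
move=> F mF tF mUF; rewrite /density_measure ge0_integral_bigcup//; last first.
  exact: measurable_funTS.
by apply: is_cvg_ereal_nneg_natsum_cond => n _ _; exact: integral_ge0.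
Qed.

HB.instance Definition _ := isMeasure.Build _ _ _ (density_measure mf f0)
  nu0 nu_ge0 nu_sigma_additive.

Definition density : {measure set T -> \bar R} := density_measure mf f0.

Lemma densityE A : density A = (\int[mu]_(x in A) f x)%E.
Proof. by []. Qed.

End density_measure.

(** * Disjoint families of sets and coverings *)

Section disjoint_families.
Context d (T : measurableType d) (R : realType).
Implicit Types (mu nu : {measure set T -> \bar R}).

(** For each [n], only finitely many disjoint subsets of [B] can have measure above 1/(n+1): an
    infinite subfamily would contain enough of them to exceed [mu B]. Then take the union over
    [n]. *)
Lemma countable_trivIset_measure mu (J : choiceType) (D : set J)
    (A : J -> set T) (B : set T) :
  measurable B -> (mu B < +oo)%E -> trivIset D A ->
  (forall i, D i -> [/\ measurable (A i), A i `<=` B & (0 < mu (A i))%E]) ->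
  countable D.
Proof.
move=> mB Boo tA DA.
have Afin i : D i -> mu (A i) \is a fin_num.
  move=> /DA[mA AB _]; rewrite ge0_fin_numE//.
  by apply: le_lt_trans Boo; apply: le_measure; rewrite ?inE.
have -> : D = \bigcup_n (D `&` [set i | n.+1%:R^-1 < fine (mu (A i))]).
  apply/seteqP; split=> [i Di|i [n _] []//].
  have : 0 < fine (mu (A i)).
    by rewrite fine_gt0//; have [_ _ ->] := DA i Di; rewrite /= -ge0_fin_numE// Afin.
  by move=> /ltr_add_invr[k /[!add0r] kXr]; exists k.
apply: bigcup_countable => // n _; apply: finite_set_countable.
apply: contrapT => /infiniteP/card_leP[g].
have kT (k : nat) : k \in [set: nat] by rewrite inE.
pose q k := val (g (SigSub (kT k))).
have q_fun k : D (q k) /\ n.+1%:R^-1 < fine (mu (A (q k))).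
  exact: set_mem (valP (g (SigSub (kT k)))).
have q_inj i j : q i = q j -> i = j.
  by move=> /val_inj/inj; rewrite !inE => /(_ I I) [].
have Dq k : D (q k) by have [] := q_fun k.
have tq : trivIset [set: nat] (fun k => A (q k)).
  move=> i j _ _ Aij; apply: q_inj.
  exact: tA (Dq i) (Dq j) Aij.
have [N NB] : exists N, fine (mu B) < N.+1%:R / n.+1%:R.
  exists (Num.truncn (fine (mu B) * n.+1%:R)).
  by rewrite ltr_pdivlMr// truncnS_gt.
have : (mu (\big[setU/set0]_(k < N.+1) A (q k)) <= mu B)%E.
  apply: le_measure; rewrite ?inE//; last first.
    by rewrite -(bigcup_mkord _ (fun k => A (q k))) => t [k _]; have [_ + _] := DA _ (Dq k); apply.
  by apply: bigsetU_measurable => k _; have [] := DA _ (Dq k).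
rewrite (@measure_bigsetU _ _ _ _ (fun k => A (q k)))//; last by move=> k; have [] := DA _ (Dq k).
rewrite -EFin_sum_fine//; last by move=> k _; exact: Afin.
rewrite -[leRHS]fineK ?ge0_fin_numE// lee_fin leNgt => /negP; apply.
rewrite (lt_le_trans NB)//.
rewrite (_ : _ / _ = \sum_(i < N.+1) n.+1%:R^-1); last first.
  by rewrite sumr_const card_ord -[RHS]mulr_natl.
by apply: ler_sum => k _; apply/ltW; have [] := q_fun k.
Qed.

(** The sets [A i] are large and cover, the sets [G i] are small and disjoint: subadditivity on the
    first and additivity on the second transfer the termwise bound. An injection of [D] into the
    naturals, whose fibres have at most one element, turns both families into sequences. *)
Lemma le_measure_cover nu (J : choiceType) (D : set J) (A G : J -> set T)
    (F L : set T) (K : R) : 0 <= K ->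
  countable D -> measurable F -> measurable L ->
  (forall i, D i -> [/\ measurable (A i), measurable (G i) &
     (nu (A i) <= K%:E * nu (G i))%E]) ->
  trivIset D G -> F `<=` \bigcup_(i in D) A i ->
  (forall i, D i -> G i `<=` L) ->
  (nu F <= K%:E * nu L)%E.
Proof.
move=> K0 /countable_injP[f finj] mF mL DAG tG FA GL.
pose D_ n := D `&` f @^-1` [set n].
have D_E n : D_ n = set0 \/ exists2 i, D i & D_ n = [set i].
  have [->|/set0P[i [Di fi]]] := eqVneq (D_ n) set0; [by left|right].
  exists i => //; apply/seteqP; split=> [j [Dj fj]|_ -> //].
  by apply: finj; rewrite ?inE// fj fi.
pose A' n := \bigcup_(i in D_ n) A i; pose G' n := \bigcup_(i in D_ n) G i.
have mA' n : measurable (A' n).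
  rewrite /A'; have [->|[i Di ->]] := D_E n; first by rewrite bigcup_set0.
  by rewrite bigcup_set1; have [] := DAG _ Di.
have mG' n : measurable (G' n).
  rewrite /G'; have [->|[i Di ->]] := D_E n; first by rewrite bigcup_set0.
  by rewrite bigcup_set1; have [] := DAG _ Di.
have AG' n : (nu (A' n) <= K%:E * nu (G' n))%E.
  rewrite /A' /G'; have [->|[i Di ->]] := D_E n.
    by rewrite !bigcup_set0 measure0 mule0.
  by rewrite !bigcup_set1; have [] := DAG _ Di.
have tG' : trivIset [set: nat] G'.
  move=> m n _ _ [t [[i [Di /= <-] ti] [j [Dj /= <-] tj]]].
  by congr f; apply: tG => //; exists t.
have FA' : F `<=` \bigcup_n A' n.
  by move=> t /FA[i Di ti]; exists (f i) => //; exists i.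
apply: le_trans (measure_sigma_subadditive _ mA' mF FA') _.
apply: (@le_trans _ _ (\sum_(n <oo) K%:E * nu (G' n))%E).
  by apply: lee_nneseries.
rewrite nneseriesZl//; apply: lee_wpmul2l; first by rewrite lee_fin.
have -> : (\sum_(n <oo) nu (G' n) = nu (\bigcup_n G' n))%E.
  by rewrite measure_bigcup//; apply: eq_eseriesl => i; rewrite in_setT.
apply: le_measure; rewrite ?inE//; first exact: bigcup_measurable.
by move=> t [n _ [i [Di _] Git]]; exact: GL Git.
Qed.

End disjoint_families.

(** * Real powers, and powers on the extended half-line *)

Section powers.
Context {R : realType}.
Implicit Types a b r s t : R.

Lemma powR_antitone a s t : 0 <= a -> 0 < s -> s <= t -> t `^ (- a) <= s `^ (- a).
Proof.
move=> a0 s0 st; have t0 := lt_le_trans s0 st.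
rewrite !powRN lef_pV2 ?posrE ?powR_gt0//.
by apply: ge0_ler_powR => //; rewrite nnegrE ltW.
Qed.

Lemma powRNK t a : 0 < t -> t `^ (- a) * t `^ a = 1.
Proof. by move=> t0; rewrite powRN mulVf// gt_eqF// powR_gt0. Qed.

Lemma powRV t a : 0 <= t -> t^-1 `^ a = t `^ (- a).
Proof. by move=> t0; rewrite -powR_inv1// -powRrM mulN1r. Qed.

End powers.

Section epow_theory.
Context {R : realType}.
Implicit Types (x : \bar R) (a b : R).

Lemma epow_ge0 x a : (0 <= epow x a)%E.
Proof.
by rewrite /epow; case: ifP => _; [rewrite inve_ge0|]; exact: poweR_ge0.
Qed.

Lemma epowxa0 x : epow x 0 = 1%E.
Proof. by rewrite /epow ltxx poweRe0. Qed.

Lemma epow0P a : 0 < a -> epow 0%E a = 0%E.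
Proof. by move=> a0; rewrite /epow ltNge ltW//= powR0 ?gt_eqF. Qed.

(** The conventions at 0 and +oo are compatible with composition; this identifies the dual weight in
    the A_p condition as again a power of the distance, also on the zero set of the distance. *)
Lemma epow_epow (x : R) a b : 0 <= x -> b < 0 ->
  epow (epow x%:E a) b = epow x%:E (a * b).
Proof.
move=> + b0; rewrite le_eqVlt => /predU1P[<-|x0]; last first.
  by rewrite !epow_EFin ?powR_gt0// powRrM.
have [a0|a0|->] := ltgtP a 0.
- by rewrite epow0N// epowyN// epow0P// nmulr_rgt0.
- by rewrite epow0P// !epow0N// pmulr_rlt0.
- by rewrite mul0r !epowxa0 epow_EFin// powR1.
Qed.

End epow_theory.

(** * Pointwise bounds and measurability of the distance weight *)

Section distance_weight.
Context {R : realType} {d : measure_display}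
  {X : completeMetricMeasurableType R d} (E : set X).
Implicit Types (x : X) (r s a b : R).

Lemma dist_weight_ge0 a x : (0 <= dist_weight E a x)%E.
Proof. exact: epow_ge0. Qed.

Lemma dist_weight0 : dist_weight E 0 = cst 1%E.
Proof. by apply/funext => x; rewrite /dist_weight oppr0 epowxa0. Qed.

Lemma dist_weight_gt0 a x : 0 < set_dist x E ->
  dist_weight E a x = (set_dist x E `^ (- a))%:E.
Proof. by move=> x0; rewrite /dist_weight epow_EFin. Qed.

Lemma dist_weightN b x : 0 <= b ->
  dist_weight E (- b) x = (set_dist x E `^ b)%:E.
Proof. by move=> b0; rewrite /dist_weight opprK /epow ltNge b0. Qed.

Lemma le_dist_weight a x s : 0 <= a -> 0 < s -> set_dist x E <= s ->
  ((s `^ (- a))%:E <= dist_weight E a x)%E.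
Proof.
move=> a0 s0 xs; have := set_dist_ge0 x E.
rewrite le_eqVlt => /predU1P[x0|x0]; last first.
  by rewrite dist_weight_gt0// lee_fin powR_antitone.
move: a0; rewrite le_eqVlt => /predU1P[<-|a0].
  by rewrite dist_weight0 oppr0 powRr0.
by rewrite /dist_weight -x0 epow0N ?oppr_lt0// leey.
Qed.

Lemma dist_weight_le a x s : 0 <= a -> 0 < s -> s <= set_dist x E ->
  (dist_weight E a x <= (s `^ (- a))%:E)%E.
Proof.
move=> a0 s0 sx.
by rewrite dist_weight_gt0 ?(lt_le_trans s0)// lee_fin powR_antitone.
Qed.

Lemma epow_dist_weight a b : b < 0 ->
  (fun x => epow (dist_weight E a x) b) = dist_weight E (a * b).
Proof.
move=> b0; apply/funext => x.
by rewrite /dist_weight epow_epow ?set_dist_ge0// mulNr.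
Qed.

Hypothesis borel_measurable : @borel R d X `<=` measurable.
Hypothesis E0 : E !=set0.

Lemma open_borel_measurable (U : set X) : open U -> measurable U.
Proof. by move=> oU; apply: borel_measurable; exact: sub_sigma_algebra. Qed.

Lemma measurable_ball x r : measurable (ball x r).
Proof. exact/open_borel_measurable/metric_ball_open. Qed.

Lemma measurable_set_nbhd r : measurable (set_nbhd E r).
Proof. exact/open_borel_measurable/open_set_nbhd. Qed.

Lemma measurable_set_dist_ge r : measurable [set x | r <= set_dist x E].
Proof.
rewrite (_ : [set _ | _] = ~` set_nbhd E r).
  exact/measurableC/measurable_set_nbhd.
apply/seteqP; split=> x /=; first by rewrite leNgt => /negP.
by move=> /negP; rewrite -leNgt.
Qed.

Lemma measurable_set_dist : measurable_fun [set: X] (fun x => set_dist x E).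
Proof.
apply: (measurability _ (RGenOInfty.measurableE R)) => //.
move=> _ [_ [r ->] <-]; rewrite setTI.
rewrite (_ : _ @^-1` _ = [set x | r < set_dist x E]).
  exact/open_borel_measurable/open_set_dist_gt.
by apply/seteqP; split=> x; rewrite /= in_itv/= andbT.
Qed.

Lemma measurable_dist_weight a : measurable_fun [set: X] (dist_weight E a).
Proof.
(* Distances being nonnegative, the test singles out distance 0, where the value is constant;
   elsewhere the weight is an ordinary real power. *)
rewrite (_ : dist_weight E a = (fun x => if set_dist x E <= 0 then
   epow 0%E (- a) else (set_dist x E `^ (- a))%:E)).
  apply: measurable_fun_ifT => //=.
    by apply: measurable_fun_ler => //; exact: measurable_set_dist.
  apply/measurable_EFinP.
  exact: (measurableT_comp (measurable_powR (- a)) measurable_set_dist).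
apply/funext => x; case: ifPn => [x0|]; last first.
  by rewrite -ltNge => x0; rewrite dist_weight_gt0.
have x00 : set_dist x E = 0 by apply/eqP; rewrite eq_le x0 set_dist_ge0.
by rewrite /dist_weight x00.
Qed.

End distance_weight.

(** * Iterated doubling and the quantitative form of weak porosity *)

Section doubling.
Context {R : realType} {d : measure_display}
  {X : completeMetricMeasurableType R d} (mu : {measure set X -> \bar R}).
Implicit Types (x y : X) (r s : R) (E : set X).

Definition doubling_with (M : R) := forall x r, 0 < r ->
  [/\ (0 < mu (ball x r))%E, (mu (ball x r) < +oo)%E &
      (mu (ball x (2 * r)) <= M%:E * mu (ball x r))%E].

Lemma doubling_measureW : doubling_measure mu ->
  exists2 M, 1 <= M & doubling_with M.
Proof.
move=> [C C0 CM]; exists (Num.max 1 C); first by rewrite le_max lexx.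
move=> x r r0; have [_ h2 h3] := CM x r r0; split.
(* Positivity is assumed for doubled balls only, hence the radius [r / 2]. *)
- have [+ _ _] := CM x (r / 2) ltac:(by rewrite divr_gt0).
  by rewrite mulrC divfK.
- by move: h3; rewrite !ltey; apply: contraNN => /eqP ->; rewrite gt0_muley ?lte_fin.
- by apply: (le_trans h2); rewrite lee_wpmul2r// lee_fin le_max lexx orbT.
Qed.

Lemma doubling_iter M (n : nat) x r : doubling_with M -> 0 <= M -> 0 < r ->
  (mu (ball x (2 ^+ n * r)) <= (M ^+ n)%:E * mu (ball x r))%E.
Proof.
move=> dM M0 r0; elim: n => [|n IH]; first by rewrite !expr0 mul1r mul1e.
rewrite exprS -mulrA; have [_ _ h] := dM x (2 ^+ n * r) ltac:(by rewrite mulr_gt0// exprn_gt0).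
by apply: (le_trans h); rewrite exprS EFinM -muleA lee_wpmul2l.
Qed.

Lemma hole_doubling_iter E D (n : nat) x r : 0 <= D ->
  (forall x r, 0 < r -> hole E x (2 * r) <= D * hole E x r) -> 0 < r ->
  hole E x (2 ^+ n * r) <= D ^+ n * hole E x r.
Proof.
move=> D0 dD r0; elim: n => [|n IH]; first by rewrite !expr0 !mul1r.
rewrite exprS -mulrA (le_trans (dD _ _ _)) ?mulr_gt0 ?exprn_gt0//.
by rewrite exprS -mulrA ler_wpM2l.
Qed.

Definition far_part E (t : R) x r := ball x r `&` [set y | t * hole E x r <= set_dist y E].

Definition porous_with E (c t : R) := forall x r, 0 < r -> 0 < hole E x r /\
  (c%:E * mu (ball x r) <= mu (far_part E t x r))%E.

(* Halving the balls given by weak porosity keeps them at distance at least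
   [delta * hole E x r / 2] from [E], and costs one doubling constant. *)
Lemma weakly_porousW E M : @borel R d X `<=` measurable -> E !=set0 ->
  doubling_with M -> 1 <= M -> weakly_porous mu E ->
  exists c t, [/\ 0 < c, 0 < t <= 1 / 2 & porous_with E c t].
Proof.
move=> bm E0 dM M1 [c [t [/andP[c0 c1] /andP[t0 t1] wp]]].
have M0 : 0 < M := lt_le_trans ltr01 M1.
exists (c / M), (t / 2); split; rewrite ?divr_gt0//; first lra.
move=> x r r0; have [N [y [s [ysub ytriv ys ysum]]]] := wp x r r0.
have [mu0 muoo _] := dM x r r0.
have s0 i : 0 < s i by have [] := ysub i.
split.
  (* The family cannot be empty, as its total measure is positive; any of its balls then shows that
     the hole is positive. *)
  have [N0|N0] := posnP N.
    have : (0 < c%:E * mu (ball x r))%E by rewrite mule_gt0.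
    move=> /lt_le_trans/(_ ysum); rewrite big1 ?ltxx// => i.
    by have := ltn_ord i; rewrite {2}N0.
  have i : 'I_N := Ordinal N0.
  have /andP[_ s2] := ys i.
  by rewrite (lt_le_trans (s0 i))// (le_hole _ (proj2 (ysub i)))// s0.
have mb z u : measurable (ball z u : set X) by exact: measurable_ball.
pose G := \big[setU/set0]_(i < N) ball (y i) (s i / 2).
have GF : G `<=` far_part E (t / 2) x r.
  rewrite /G; apply: (big_ind (fun A => A `<=` far_part E (t / 2) x r)) => //.
    by move=> A B AF BF z [/AF|/BF].
  move=> i _ z zi; have [_ sub] := ysub i; split.
    by have [] : (ball x r `\` E) z by apply/sub/(le_ball _ zi); have := s0 i; lra.
  rewrite /= (@le_trans _ _ (s i / 2))//.
    by have /andP[+ _] := ys i; lra.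
  apply: ball_le_set_dist => // w zw.
  have [] // : (ball x r `\` E) w.
  apply: sub; apply: (subset_ball_triangle _ zw).
  by move: zi; rewrite ballEmdist/=; lra.
have mG : measurable G by exact: bigsetU_measurable.
have mF : measurable (far_part E (t / 2) x r).
  by apply: measurableI; [exact: mb|exact: measurable_set_dist_ge].
apply: (@le_trans _ _ (mu G)); last by apply: le_measure; rewrite ?inE.
rewrite /G measure_bigsetU_ord//; last first.
  move=> i j _ _ [z [zi zj]]; apply: ytriv => //; exists z; split.
    by apply: le_ball zi; have := s0 i; lra.
  by apply: le_ball zj; have := s0 j; lra.
rewrite mulrC EFinM -muleA lee_pdivrMl// (le_trans ysum)//.
rewrite ge0_sume_distrr//; apply: lee_sum => i _.
have [_ _ +] := dM (y i) (s i / 2) ltac:(by rewrite divr_gt0).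
by rewrite mulrCA mulfV// mulr1.
Qed.

End doubling.

(** * Auxiliary inequalities for extended reals, integrals and maximal families *)

Section ereal_quotients.
Context {R : realType}.
Implicit Types (x b : \bar R) (c : R).
Local Open Scope ereal_scope.

Lemma lee_pinveMl x b c : 0 < b -> b < +oo ->
  (b^-1 * x <= c%:E) = (x <= c%:E * b).
Proof.
case: b => [b|//|//]; rewrite lte_fin => b0 _.
by rewrite inver gt_eqF// lee_pdivrMl// muleC.
Qed.

Lemma lee_pinveMr x b c : 0 < b -> b < +oo ->
  (c%:E <= b^-1 * x) = (c%:E * b <= x).
Proof.
case: b => [b|//|//]; rewrite lte_fin => b0 _.
by rewrite inver gt_eqF// lee_pdivlMl// muleC.
Qed.

(** Widman's hole-filling trick: add [x <= (K + 1) * y] and [(K + 1) * x <= (K + 1) * z]. Having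
    [K + 1] in place of [K] keeps the ratio [(K + 1) / (K + 2)] positive even for [K = 0], so that
    its logarithm can be taken. *)
Lemma hole_filling (K : R) (x y z : \bar R) : (0 <= K)%R ->
  0 <= x -> 0 <= y -> 0 <= z -> x <= K%:E * y -> x <= z ->
  (K + 2)%:E * x <= (K + 1)%:E * (y + z).
Proof.
move=> K0 x0 y0 z0 xKy xz.
have K1 : 0 <= (K + 1)%:E by rewrite lee_fin addr_ge0.
rewrite (_ : (K + 2 = 1 + (K + 1))%R); last ring.
rewrite EFinD ge0_muleDl// mul1e ge0_muleDr//; apply: leeD.
  by rewrite (le_trans xKy)// lee_wpmul2r// lee_fin lerDl.
exact: lee_wpmul2l.
Qed.

End ereal_quotients.


Section constant_bounds.
Context d (T : measurableType d) (R : realType) (mu : {measure set T -> \bar R}).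
Implicit Types (A : set T) (f : T -> \bar R) (m : R).

Lemma cst_le_integral A f m : 0 <= m -> measurable A -> measurable_fun A f ->
  (forall x, A x -> (m%:E <= f x)%E) ->
  (m%:E * mu A <= \int[mu]_(x in A) f x)%E.
Proof.
move=> m0 mA mf mf_le; rewrite -integral_cst//; apply: ge0_le_integral => //.
Qed.

Lemma integral_le_cst A f m : measurable A -> measurable_fun A f ->
  (forall x, A x -> (0 <= f x)%E) ->
  (forall x, A x -> (f x <= m%:E)%E) ->
  (\int[mu]_(x in A) f x <= m%:E * mu A)%E.
Proof.
by move=> mA mf f0 fm; rewrite -integral_cst//; apply: ge0_le_integral.
Qed.

End constant_bounds.

(** Otherwise adjoining [z] would enlarge [V]; nonemptiness of [B z] ensures that [z] is not already
    in [V]. *)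
Lemma maximal_disjoint_meets (I T : Type) (B : I -> set T) (V F : set I) z :
  maximal_disjoint_subcollection B V F -> F z -> B z !=set0 ->
  exists2 y, V y & B y `&` B z !=set0.
Proof.
move=> [VF tV Vmax] Fz Bz0; apply: contrapT => nex.
have nVz y : V y -> ~ (B y `&` B z !=set0) by move=> Vy yz; apply: nex; exists y.
apply: (Vmax (V `|` [set z])).
- split; first by move=> y Vy; left.
  by move=> /(_ z (or_intror erefl)) Vz; apply: (nVz z) => //; rewrite setIid.
- by move=> y [/VF//|->].
- move=> i j [Vi|->] [Vj|->]//; first exact: tV.
    by move=> /(nVz _ Vi).
  by rewrite setIC => /(nVz _ Vj).
Qed.

(** * Self-improvement of a good exponent; [avgW] says that [a] is good *)

Section self_improvement.
Context {R : realType} {d : measure_display}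
  {X : completeMetricMeasurableType R d} (mu : {measure set X -> \bar R}).
Variables (E : set X) (M D c t a K0 : R).
Hypotheses (bm : @borel R d X `<=` measurable) (E0 : E !=set0)
  (M1 : 1 <= M) (dM : doubling_with mu M)
  (D1 : 1 <= D)
  (dD : forall x r, 0 < r -> hole E x (2 * r) <= D * hole E x r)
  (c0 : 0 < c) (t01 : 0 < t <= 1 / 2) (pE : porous_with mu E c t)
  (a0 : 0 <= a) (K00 : 0 <= K0)
  (avgW : forall x r, 0 < r ->
    (\int[mu]_(y in ball x r) dist_weight E a y <=
     (K0 * hole E x r `^ (- a))%:E * mu (ball x r))%E).
Implicit Types (x y z : X) (r s u : R).

Let D0 : 0 < D := lt_le_trans ltr01 D1.
Let M0 : 0 < M := lt_le_trans ltr01 M1.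

(** The hole in a ball is at most twice the radius, so halving [s] repeatedly brings it below [u];
    take the first such radius. It is not [s] itself, so its double still has a hole above [u]. *)
Lemma hole_scale_radius y s u : 0 < u -> 0 < s -> u < hole E y s ->
  exists r, [/\ 0 < r, r < s, hole E y r <= u & u < hole E y (2 * r)].
Proof.
move=> u0 s0 us.
have ex : exists n, hole E y (s / 2 ^+ n) <= u.
  have [n nu] : exists n : nat, 2 * s / u < n%:R.
    by exists (Num.truncn (2 * s / u)).+1; rewrite truncnS_gt.
  exists n; rewrite (le_trans (hole_le2r _ _ _)) ?divr_ge0 ?exprn_ge0 ?(ltW s0)//.
  rewrite mulrA ler_pdivrMr ?exprn_gt0// [leRHS]mulrC -ler_pdivrMr// (le_trans (ltW nu))//.
  by rewrite -natrX ler_nat ltnW// ltn_expl.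
have [[|n] nP nmin] := ex_minnP ex.
  by move: nP; rewrite expr0 divr1 leNgt us.
have p0 : 0 < (2:R) ^+ n by rewrite exprn_gt0.
exists (s / 2 ^+ n.+1); split=> //.
- by rewrite divr_gt0 ?exprn_gt0.
- by rewrite ltr_pdivrMr ?exprn_gt0// ltr_pMr// exprn_egt1// ltr1n.
- rewrite (_ : 2 * _ = s / 2 ^+ n); last by rewrite exprS; field; lra.
  by rewrite ltNge; apply/negP => /nmin; rewrite ltnn.
Qed.

Lemma hole_ge_pow y r (n : nat) : 0 < r ->
  hole E y r <= D ^+ n * hole E y (r / 2 ^+ n).
Proof.
move=> r0; have := @hole_doubling_iter R d X E D n y (r / 2 ^+ n) (ltW D0) dD.
have -> : 2 ^+ n * (r / 2 ^+ n) = r.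
  by rewrite mulrCA divff ?mulr1// gt_eqF// exprn_gt0.
by apply; rewrite divr_gt0 ?exprn_gt0.
Qed.

(** [K0] comes from goodness on a ball of radius [rad y], [M ^+ 3] from shrinking it to [rad y / 8],
    [c] from porosity there. On the far part the distance is below [3 * D * u], while the hole of
    the large ball is at least [u / D]: the ratio is [3 * D ^+ 2]. *)
Definition layer_const := K0 * M ^+ 3 / c * (3 * D ^+ 2) `^ a.

Let W := dist_weight E a.
Let mW : measurable_fun [set: X] W := measurable_dist_weight bm E0 a.
Let W0 : forall x, (0 <= W x)%E := dist_weight_ge0 E a.

(* Radii [rad y] at which the hole size is comparable to [u] vary slowly with
   [y], so a maximal disjoint family of balls of radius [rad y / 8] covers once
   enlarged by the factor 8. *)
Lemma layer_step x r s u : 0 < u -> 0 < r -> 0 < s ->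
  (forall y, ball x r y -> u < hole E y s) ->
  (\int[mu]_(y in set_nbhd E (t / D ^+ 4 * u) `&` ball x r) W y <=
   layer_const%:E *
   \int[mu]_(y in (set_nbhd E (3 * D * u) `\` set_nbhd E (t / D ^+ 4 * u))
                  `&` ball x (r + s)) W y)%E.
Proof.
move=> u0 r0 s0 us; set eps := t / D ^+ 4.
set F := _ `&` ball x r; set L := _ `&` ball x (r + s).
have [/andP[t0 t1] [D40 D30]] : 0 < t <= 1 / 2 /\ (0 < D ^+ 4 /\ 0 < D ^+ 3).
  by rewrite !exprn_gt0.
have D31 : 1 <= D ^+ 3 by rewrite exprn_ege1.
have eps0 : 0 < eps by rewrite divr_gt0.
have epsD : eps * D <= 1 / 2.
  have -> : eps * D = t / D ^+ 3 by rewrite /eps; field; rewrite gt_eqF.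
  by rewrite ler_pdivrMr//; lra.
have mb z v : measurable (ball z v : set X) by exact: measurable_ball.
have mn v : measurable (set_nbhd E v) by exact: measurable_set_nbhd.
(* Outside [F] the radius is the placeholder 0. *)
have /choice[rad radP] : forall y, exists v, F y ->
    [/\ 0 < v, v < s, hole E y v <= u & u < hole E y (2 * v)].
  move=> y.
  have [Fy|Fy] := pselect (F y); last by exists 0.
  by have [v ?] := hole_scale_radius u0 s0 (us y Fy.2); exists v.
have [V [VF tV Vmax]] := ex_maximal_disjoint_subcollection
  (fun y => ball y (rad y / 8)) F.
have radV y : V y -> [/\ 0 < rad y, rad y < s, hole E y (rad y) <= u
  & u < hole E y (2 * rad y)] by move=> /VF/radP.
pose G y := far_part E t y (rad y / 8).
have mG y : measurable (G y).
  by apply: measurableI => //; exact: measurable_set_dist_ge.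
have hu y : F y -> u < D * hole E y (rad y).
  move=> /radP[ry0 _ _ u2]; exact: lt_le_trans u2 (dD _ ry0).
(* One doubling from [2 * rad y] to [rad y] and three more down to [rad y / 8]. This is the origin
   of [D ^+ 4] in [eps]: the far part of the small ball stays at distance at least [eps * u] from
   [E]. *)
have hu4 y : F y -> u < D ^+ 4 * hole E y (rad y / 8).
  move=> Fy; have [ry0 _ _ _] := radP _ Fy; apply: (lt_le_trans (hu _ Fy)).
  rewrite exprS -mulrA ler_pM2l//.
  by have := @hole_ge_pow y (rad y) 3 ry0; rewrite -natrX.
have Gdist y z : F y -> ball y (rad y / 8) z -> set_dist z E < 3 * D * u.
  move=> Fy; rewrite ballEmdist/= => yz; have [ry0 _ _ _] := radP _ Fy.
  have yE : set_dist y E < rad y.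
    case: Fy (hu _ Fy) => + _ hy; rewrite /set_nbhd/= => /lt_le_trans; apply.
    have ur : u <= D * (2 * rad y).
      by rewrite (le_trans (ltW hy))// ler_pM2l// hole_le2r// ltW.
    rewrite (@le_trans _ _ (eps * D * (2 * rad y)))//.
      by rewrite -mulrA ler_pM2l.
    by rewrite mulrA ger_pMl//; lra.
  have [zE|zE] := leP (set_dist z E) 0.
    by apply: (le_lt_trans zE); rewrite !mulr_gt0.
  (* The ball of radius [v] at [z] is a hole in the ball of radius [2 * rad y] at [y], so
     [v <= D * u]. As the distance of [z] is below [2 * rad y], it is at most [2 * v]. *)
  pose v := Num.min (set_dist z E) (rad y).
  have v0 : 0 < v by rewrite lt_min zE.
  have vr : v <= rad y by rewrite ge_min lexx orbT.
  have vh : v <= hole E y (2 * rad y).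
    apply: (@le_hole _ _ _ _ _ _ z); first by rewrite v0; lra.
    move=> w zw; split; first by apply: subset_ball_triangle zw; lra.
    by apply: (@ball_set_dist _ _ _ z v) => //; rewrite ge_min lexx.
  have vDu : v <= D * u.
    by rewrite (le_trans vh)// (le_trans (dD _ ry0))// ler_pM2l//; have [] := radP _ Fy.
  have zr : set_dist z E < 2 * rad y.
    by have := set_dist_lip z y E0; rewrite metric_sym; lra.
  have : set_dist z E <= 2 * v.
    by rewrite /v; case: (leP (set_dist z E) (rad y)) => _; lra.
  by have : 0 < D * u := mulr_gt0 D0 u0; lra.
have GL y : V y -> G y `<=` L.
  move=> Vy z [yz zG]; have [ry0 rs _ _] := radV _ Vy.
  have Fy := VF _ Vy; split; [split|].
  - exact: Gdist yz.
  - rewrite /set_nbhd/= => zlt; move: zG; rewrite /= leNgt => /negP; apply.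
    rewrite (lt_le_trans zlt)// /eps -mulrA ler_pM2l// mulrC ler_pdivrMr//.
    by rewrite mulrC; exact/ltW/hu4.
  - case: Fy => _; rewrite ballEmdist/= => xy.
    by apply: (subset_ball_triangle _ yz); lra.
have cK : 0 <= K0 * M ^+ 3 / c.
  by rewrite divr_ge0 ?mulr_ge0 ?exprn_ge0 ?(ltW c0) ?(ltW M0).
have K1_ge0 : 0 <= layer_const by rewrite mulr_ge0 ?powR_ge0.
pose nu := density mu mW W0.
have nuAG y : V y -> (nu (ball y (rad y)) <= layer_const%:E * nu (G y))%E.
  move=> Vy; have [ry0 _ _ _] := radV _ Vy.
  have r80 : 0 < rad y / 8 by rewrite divr_gt0.
  apply: (le_trans (avgW y ry0)).
  have h1 : (mu (ball y (rad y)) <= (M ^+ 3)%:E * mu (ball y (rad y / 8)))%E.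
    have := doubling_iter 3 y dM (ltW M0) r80.
    by rewrite (_ : 2 ^+ 3 * _ = rad y)//; field.
  have h2 : (mu (ball y (rad y / 8)) <= c^-1%:E * mu (G y))%E.
    by rewrite lee_pdivlMl//; exact: (pE y r80).2.
  have h3 : (((3 * D * u) `^ (- a))%:E * mu (G y) <= nu (G y))%E.
    apply: cst_le_integral => //; first exact: powR_ge0.
      exact: measurable_funTS.
    move=> z [yz _]; apply: le_dist_weight => //; first by rewrite !mulr_gt0.
    by apply/ltW; apply: Gdist yz; exact: VF.
  have h4 : hole E y (rad y) `^ (- a) <= (u / D) `^ (- a).
    apply: powR_antitone => //; first by rewrite divr_gt0.
    by rewrite ler_pdivrMr// mulrC; apply/ltW/hu/VF.
  apply: (@le_trans _ _ ((K0 * (u / D) `^ (- a) * (M ^+ 3 / c))%:E * mu (G y))%E).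
    rewrite [in leRHS]EFinM -muleA; apply: lee_pmul => //.
    - by rewrite lee_fin mulr_ge0// powR_ge0.
    - by rewrite lee_fin ler_wpM2l.
    - by rewrite EFinM -muleA (le_trans h1)// lee_wpmul2l// lee_fin ltW// exprn_gt0.
  have -> : K0 * (u / D) `^ (- a) * (M ^+ 3 / c) =
      layer_const * (3 * D * u) `^ (- a).
    rewrite (_ : 3 * D * u = 3 * D ^+ 2 * (u / D)); last by field; rewrite gt_eqF.
    have uD0 : 0 < u / D by rewrite divr_gt0.
    have D20 : 0 < 3 * D ^+ 2 by rewrite mulr_gt0 ?exprn_gt0.
    rewrite (powRM _ (ltW D20) (ltW uD0)) /layer_const.
    have e := powRNK a D20.
    rewrite [RHS](_ : _ = K0 * (u / D) `^ (- a) * (M ^+ 3 / c) *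
      ((3 * D ^+ 2) `^ (- a) * (3 * D ^+ 2) `^ a)); last by ring.
    by rewrite e mulr1.
  by rewrite EFinM -muleA lee_wpmul2l.
have mL : measurable L.
  by apply: measurableI => //; apply: measurableD.
have mF : measurable F by apply: measurableI.
have cV : countable V.
  apply: (@countable_trivIset_measure _ _ _ mu _ V (fun y => ball y (rad y / 8))
    (ball x (r + s))) => //.
    by have [] := dM x (addr_gt0 r0 s0).
  move=> y Vy; have [ry0 rs _ _] := radV _ Vy; split => //.
    case: (VF _ Vy) => _; rewrite ballEmdist/= => xy.
    by apply: subset_ball_triangle; lra.
  by have [] := @dM y (rad y / 8) ltac:(by rewrite divr_gt0).
apply: (@le_measure_cover _ _ _ nu _ V (fun y => ball y (rad y)) G) => //.
- by move=> y Vy; split => //; exact: nuAG.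
- move=> i j Vi Vj [w [[wi _] [wj _]]]; apply: tV => //.
  by exists w.
- move=> z Fz; have [rz0 _ hz _] := radP _ Fz.
  have [|y Vy [w [wy wz]]] := maximal_disjoint_meets
    (And3 VF tV Vmax) Fz.
    by exists z; apply: mem_ball_center; rewrite divr_gt0.
  exists y => //; have [ry0 _ _ hy] := radV _ Vy.
  have yz : mdist y z < (rad y + rad z) / 8.
    move: wy wz; rewrite !ballEmdist/= => wy wz.
    by have := metric_triangle y w z; rewrite (metric_sym w z); lra.
  (* Otherwise the ball at [z] of radius [rad z] contains the one at [y] of radius [2 * rad y],
     whose hole exceeds [u], against the choice of [rad z]. *)
  have : rad z < 4 * rad y.
    rewrite ltNge; apply/negP => yz4.
    have : hole E y (2 * rad y) <= hole E z (rad z).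
      apply: hole_mono; first lra.
      by apply: subset_ball_triangle; rewrite metric_sym; lra.
    by move=> /(lt_le_trans hy); rewrite ltNge hz.
  by rewrite ballEmdist/=; lra.
Qed.

Local Definition inner_scale := t / D ^+ 4.
Local Definition decay_rate := (layer_const + 1) / (layer_const + 2).
Let nu := density mu mW W0.

Let layer_const_ge0 : 0 <= layer_const.
Proof.
by rewrite mulr_ge0 ?powR_ge0// divr_ge0 ?mulr_ge0 ?exprn_ge0 ?(ltW c0) ?(ltW M0).
Qed.

Let t0 : 0 < t. Proof. by case/andP: t01. Qed.

Let inner_scale_gt0 : 0 < inner_scale. Proof. by rewrite divr_gt0 ?exprn_gt0. Qed.

Let mball x r : measurable (ball x r : set X).
Proof. exact: measurable_ball. Qed.

Let mnbhd r : measurable (set_nbhd E r).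
Proof. exact: measurable_set_nbhd. Qed.

Let decay_rate01 : 0 < decay_rate < 1.
Proof.
have h1 : 0 < layer_const + 1 by rewrite ltr_wpDl.
have h2 : 0 < layer_const + 2 by rewrite ltr_wpDl.
by rewrite divr_gt0//= ltr_pdivrMr// mul1r ltrD2l ltr1n.
Qed.

(** The set on the right splits into the layer of [layer_step], which controls the left side, and
    the inner neighbourhood in the larger ball, which contains it; hole filling yields a factor
    below 1. *)
Lemma layer_decay x r s u : 0 < u -> 0 < r -> 0 < s ->
  (forall y, ball x r y -> u < hole E y s) ->
  (nu (set_nbhd E (inner_scale * u) `&` ball x r) <=
   decay_rate%:E * nu (set_nbhd E (3 * D * u) `&` ball x (r + s)))%E.
Proof.
move=> u0 r0 s0 us.
have h2 : 0 < layer_const + 2 by rewrite ltr_wpDl.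
have step := layer_step u0 r0 s0 us; rewrite -/inner_scale -!(densityE mu mW W0) -/nu in step.
have eps3D : inner_scale <= 3 * D.
  have : inner_scale <= t.
    by rewrite ler_pdivrMr ?exprn_gt0// ler_peMr ?(ltW t0)// exprn_ege1.
  by have /andP[_] := t01; have := D1; lra.
rewrite (_ : set_nbhd E (3 * D * u) `&` ball x (r + s) =
    ((set_nbhd E (3 * D * u) `\` set_nbhd E (inner_scale * u)) `&` ball x (r + s)) `|`
    (set_nbhd E (inner_scale * u) `&` ball x (r + s))); last first.
  rewrite -setIUl setUC setDUK// => y; rewrite /set_nbhd/= => /lt_le_trans; apply.
  by rewrite ler_pM2r.
set L := (_ `\` _) `&` _ in step *; set F := _ `&` _ in step *.
set F' := set_nbhd E (inner_scale * u) `&` _.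
have mF : measurable F by exact: measurableI.
have mF' : measurable F' by exact: measurableI.
have mL : measurable L by apply: measurableI => //; exact: measurableD.
rewrite measureU//; last first.
  by apply/seteqP; split => // y [[[_ h1] _] [h3 _]]; exact: h1.
rewrite [decay_rate]mulrC EFinM -muleA lee_pdivlMl//.
have FF' : (nu F <= nu F')%E.
  apply: le_measure; rewrite ?inE//; apply: setIS.
  by apply: le_ball; rewrite lerDl ltW.
exact: hole_filling.
Qed.

(** Multiplying [u] by this ratio turns the outer width [3 * D * u] into the former inner width
    [inner_scale * u], so successive applications of [layer_decay] chain. *)
Local Definition scale_ratio := inner_scale / (3 * D).
Local Definition first_scale := (2 * D ^+ 3)^-1.

Let scale_ratio_gt0 : 0 < scale_ratio. Proof. by rewrite divr_gt0// mulr_gt0. Qed.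

Let first_scale_gt0 : 0 < first_scale. Proof. by rewrite invr_gt0 mulr_gt0// exprn_gt0. Qed.

Let scale_ratio_D : scale_ratio * D <= 1 / 6.
Proof.
have -> : scale_ratio * D = inner_scale / 3 by rewrite /scale_ratio; field; rewrite gt_eqF.
have : inner_scale <= t.
  by rewrite ler_pdivrMr ?exprn_gt0// ler_peMr ?(ltW t0)// exprn_ege1.
by have /andP[_] := t01; lra.
Qed.

(** The ball at [x] lies in the ball of radius [4 * r] at [y], and [k + 3] halvings lead from there
    to [r / 2 ^+ k.+1]. Of the cost [D ^+ k.+3], [scale_ratio ^+ k] absorbs [D ^+ k] and
    [first_scale] absorbs [D ^+ 3]; its factor 1/2 gives strictness. *)
Lemma hole_dyadic_gt x y r (k : nat) : 0 < r -> ball x (2 * r) y ->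
  scale_ratio ^+ k * (first_scale * hole E x r) < hole E y (r / 2 ^+ k.+1).
Proof.
move=> r0; rewrite ballEmdist/= => xy; have [H0 _] := pE x r0.
have h1 : hole E x r <= hole E y (4 * r).
  apply: hole_mono; first lra.
  by apply: subset_ball_triangle; rewrite metric_sym; lra.
have := le_trans h1 (@hole_ge_pow y (4 * r) k.+3 ltac:(by rewrite mulr_gt0)).
rewrite (_ : 4 * r / 2 ^+ k.+3 = r / 2 ^+ k.+1); last first.
  by rewrite (exprS _ k.+2) (exprS _ k.+1); field; rewrite expf_neq0.
set h := hole E y _ => Hh.
have qDk : (scale_ratio * D) ^+ k <= 1.
  by apply: exprn_ile1; [exact: mulr_ge0 (ltW scale_ratio_gt0) (ltW D0)|have := scale_ratio_D; lra].
have : scale_ratio ^+ k * (first_scale * hole E x r) <= scale_ratio ^+ k * (first_scale * (D ^+ k.+3 * h)).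
  by rewrite !ler_pM2l ?exprn_gt0.
move=> /le_lt_trans; apply.
have -> : scale_ratio ^+ k * (first_scale * (D ^+ k.+3 * h)) = (scale_ratio * D) ^+ k * h / 2.
  have tauD : first_scale * D ^+ 3 = 2^-1 by rewrite /first_scale; field; rewrite gt_eqF.
  rewrite (exprMn k scale_ratio D) -tauD (_ : D ^+ k.+3 = D ^+ k * D ^+ 3); last by rewrite -exprD addn3.
  by ring.
have h0 : 0 < h.
  have : 0 < D ^+ k.+3 * h by exact: lt_le_trans Hh.
  by rewrite pmulr_rgt0// exprn_gt0.
have : (scale_ratio * D) ^+ k * h <= h by rewrite ger_pMl.
lra.
Qed.

(** Each application of [layer_decay] enlarges the ball. The increments are halved at every scale,
    so the radii never exceed [2 * r]. *)
Lemma layer_decay_iter x r (k : nat) : 0 < r ->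
  (nu (set_nbhd E (inner_scale * (scale_ratio ^+ k * (first_scale * hole E x r)))
       `&` ball x (r + r / 2 ^+ k.+1)) <=
   (decay_rate ^+ k.+1)%:E * nu (ball x (2 * r)))%E.
Proof.
move=> r0; have [H0 _] := pE x r0.
have [decay_rate_gt0 decay_rate_lt1] := andP decay_rate01.
have p0 n : 0 < r / 2 ^+ n by rewrite divr_gt0 ?exprn_gt0.
have rp n : r / 2 ^+ n = r / 2 ^+ n.+1 + r / 2 ^+ n.+1.
  by rewrite exprS; field; rewrite expf_neq0.
have p1 n : r / 2 ^+ n.+1 <= r.
  by rewrite ler_pdivrMr ?exprn_gt0// ler_peMr ?(ltW r0)// exprn_ege1// ler1n.
elim: k => [|k IH].
  apply: (le_trans (@layer_decay x _ (r / 2 ^+ 1) _ _ _ _ _)) => //.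
  - by rewrite expr0 mul1r mulr_gt0.
  - by rewrite addr_gt0.
  - move=> y xy; apply: (hole_dyadic_gt 0 r0).
    by apply: le_ball xy; have := p1 0%N; lra.
  - rewrite expr1; apply: lee_wpmul2l; first by rewrite lee_fin ltW.
    apply: le_measure; rewrite ?inE//; first exact: measurableI.
    by move=> y [_]; apply: le_ball; lra.
apply: (le_trans (@layer_decay x _ (r / 2 ^+ k.+2) _ _ _ _ _)) => //.
- by rewrite mulr_gt0 ?exprn_gt0// mulr_gt0.
- by rewrite addr_gt0.
- move=> y xy; apply: hole_dyadic_gt => //.
  by apply: le_ball xy; have := p1 k.+1; lra.
rewrite [decay_rate ^+ k.+2]exprS (EFinM decay_rate) -muleA; apply: lee_wpmul2l; first by rewrite lee_fin ltW.
rewrite -addrA -rp.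
rewrite (_ : 3 * D * _ = inner_scale * (scale_ratio ^+ k * (first_scale * hole E x r)))//.
by rewrite exprS /scale_ratio; field; rewrite gt_eqF.
Qed.

Lemma muckenhoupt_self_improvement :
  exists2 b, a < b & muckenhoupt_admissible mu E b.
Proof.
have [decay_rate_gt0 decay_rate_lt1] := andP decay_rate01.
have q1 : scale_ratio < 1.
  have : scale_ratio <= scale_ratio * D by rewrite ler_peMr// ltW.
  by have := scale_ratio_D; lra.
(* Chosen so that [scale_ratio] to the power [eta] is [decay_rate]: geometric decay becomes a power
   law. *)
pose eta := ln decay_rate / ln scale_ratio.
have lnq : ln scale_ratio < 0 by rewrite ln_lt0// scale_ratio_gt0.
have eta0 : 0 < eta by rewrite ltr_ndivlMr// mul0r ln_lt0// decay_rate_gt0.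
have qeta : scale_ratio `^ eta = decay_rate.
  by rewrite /powR gt_eqF// /eta divfK ?lt_eqF// lnK.
exists (a + eta); first by rewrite ltrDl.
pose e := inner_scale * first_scale.
have e0 : 0 < e by rewrite mulr_gt0.
(* The first summand serves the scales [s >= e * H], where the quotient of measures is bounded by 1;
   the second serves [s < e * H], where the decay applies. *)
exists (e^-1 `^ (a + eta) + K0 * M * e^-1 `^ eta) => x r s Ex r0 s0 sH _.
have [H0 _] := pE x r0; set H := hole E x r in sH H0 *.
have [m0 moo _] := dM x r0.
have mF : measurable (set_nbhd E s `&` ball x r) by exact: measurableI.
rewrite muleC lee_pinveMl//.
have Hs0 : 0 < H / s by rewrite divr_gt0.
have ae0 : 0 <= a + eta by rewrite addr_ge0// ltW.
have KM0 : 0 <= K0 * M * e^-1 `^ eta by rewrite !mulr_ge0 ?powR_ge0 ?(ltW M0).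
have [es|se] := leP (e * H) s.
  apply: (@le_trans _ _ (1%:E * mu (ball x r))%E).
    by rewrite mul1e le_measure ?inE// => y [].
  rewrite lee_wpmul2r// lee_fin mulrDl -[leLHS]addr0 lerD//; last first.
    by rewrite mulr_ge0 ?powR_ge0.
  rewrite -(@powRNK _ (H / s) (a + eta))// [leRHS]mulrC ler_wpM2l ?powR_ge0//.
  apply: ge0_ler_powR; rewrite ?nnegrE ?invr_ge0 ?(ltW e0) ?(ltW Hs0)//.
  by rewrite ler_pdivrMr// ler_pdivlMl.
pose v := s / (e * H).
have eH0 : 0 < e * H by rewrite mulr_gt0.
have v0 : 0 < v by rewrite divr_gt0.
have v1 : v < 1 by rewrite ltr_pdivrMr// mul1r.
have ex : exists n, scale_ratio ^+ n <= v.
  exists (Num.truncn (ln v / ln scale_ratio)).+1; set n := _.+1.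
  have : ln v / ln scale_ratio < n%:R by rewrite truncnS_gt.
  rewrite ltr_ndivrMr// => nv.
  rewrite -powR_mulrn ?(ltW scale_ratio_gt0)// /powR gt_eqF//.
  by rewrite -[leRHS](@lnK _ v)// ler_expR ltW.
(* With [k + 1] minimal, [v <= scale_ratio ^+ k] allows [k + 1] decay steps, while
   [scale_ratio ^+ k.+1 <= v] bounds the resulting factor by [v] to the power [eta]. *)
have [[|k] kv kmin] := ex_minnP ex.
  by move: kv; rewrite expr0 leNgt v1.
have vk : v <= scale_ratio ^+ k.
  by rewrite ltW// ltNge; apply/negP => /kmin; rewrite ltnn.
have sk : s <= inner_scale * (scale_ratio ^+ k * (first_scale * H)).
  move: vk; rewrite /v ler_pdivrMr// => /le_trans; apply.
  rewrite [leLHS](_ : _ = inner_scale * (scale_ratio ^+ k * (first_scale * H)))// /e; ring.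
pose F := set_nbhd E s `&` ball x r.
(* Chebyshev's inequality on the neighbourhood of width [s]. *)
have nuF : ((s `^ (- a))%:E * mu F <= nu F)%E.
  apply: cst_le_integral => //; first exact: powR_ge0.
    exact: measurable_funTS.
  by move=> y [ys _]; apply: le_dist_weight => //; exact: ltW.
have nuF2 : (nu F <= (decay_rate ^+ k.+1)%:E * nu (ball x (2 * r)))%E.
  apply: le_trans (layer_decay_iter x k r0).
  apply: le_measure; rewrite ?inE//; first exact: measurableI.
  apply: setISS; first by move=> y ys; exact: lt_le_trans ys sk.
  by apply: le_ball; rewrite lerDl divr_ge0 ?exprn_ge0 ?(ltW r0).
have nu2r : (nu (ball x (2 * r)) <= (K0 * H `^ (- a) * M)%:E * mu (ball x r))%E.
  have r20 : 0 < 2 * r by rewrite mulr_gt0.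
  apply: (le_trans (avgW x r20)); rewrite [in leRHS]EFinM -muleA; apply: lee_pmul => //.
  - by rewrite lee_fin mulr_ge0// powR_ge0.
  - rewrite lee_fin ler_wpM2l// powR_antitone//.
    by apply: hole_mono; [lra|apply: le_ball; lra].
  - by have [] := dM x r0.
have sa : s `^ a * s `^ (- a) = 1 by rewrite mulrC powRNK.
rewrite -[X in (X <= _)%E]mul1e -sa EFinM -muleA.
apply: (@le_trans _ _ ((s `^ a)%:E *
  ((decay_rate ^+ k.+1)%:E * ((K0 * H `^ (- a) * M)%:E * mu (ball x r))))%E).
  apply: lee_wpmul2l; first by rewrite lee_fin powR_ge0.
  rewrite (le_trans nuF)// (le_trans nuF2)// lee_wpmul2l// lee_fin exprn_ge0//.
  exact: ltW.
rewrite !muleA -!EFinM lee_wpmul2r// lee_fin.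
have thv : decay_rate ^+ k.+1 <= (s / H) `^ eta * e^-1 `^ eta.
  rewrite -powRM ?divr_ge0 ?invr_ge0 ?(ltW s0) ?(ltW H0) ?(ltW e0)//.
  rewrite -qeta -powR_mulrn ?powR_ge0// powRAC powR_mulrn ?(ltW scale_ratio_gt0)//.
  apply: ge0_ler_powR; rewrite ?nnegrE ?exprn_ge0 ?(ltW scale_ratio_gt0) ?(ltW eta0)//.
    by rewrite mulr_ge0 ?divr_ge0 ?invr_ge0 ?(ltW s0) ?(ltW H0) ?(ltW e0).
  by apply: (le_trans kv); rewrite /v invfM mulrA mulrAC.
have -> : (H / s) `^ (- (a + eta)) = s `^ a * H `^ (- a) * (s / H) `^ eta.
  rewrite -powRV ?(ltW Hs0)// invf_div powRD; last first.
    by rewrite gt_eqF ?implybT// ltr_wpDl.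
  congr (_ * _).
  by rewrite powRM ?invr_ge0 ?(ltW s0) ?(ltW H0)// (powRV _ (ltW H0)).
have sH0 : 0 <= s `^ a * H `^ (- a) * (s / H) `^ eta by rewrite !mulr_ge0 ?powR_ge0.
apply: (@le_trans _ _ (K0 * M * e^-1 `^ eta * (s `^ a * H `^ (- a) * (s / H) `^ eta))).
  rewrite [leRHS](_ : _ = s `^ a * (K0 * H `^ (- a) * M) *
    ((s / H) `^ eta * e^-1 `^ eta)); last by ring.
  rewrite [leLHS](_ : _ = s `^ a * (K0 * H `^ (- a) * M) * decay_rate ^+ k.+1); last by ring.
  by rewrite ler_wpM2l// !mulr_ge0 ?powR_ge0// ltW.
by rewrite ler_wpM2r// lerDr powR_ge0.
Qed.

End self_improvement.

Lemma nneseries_geometric_le (R : realType) (e z : R) : 0 <= e -> 0 <= z < 1 ->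
  (\sum_(0 <= k <oo) (e * z ^+ k)%:E <= (e / (1 - z))%:E)%E.
Proof.
move=> e0 /andP[z0 z1]; apply: lime_le.
  by apply: is_cvg_nneseries => k _ _; rewrite lee_fin mulr_ge0 ?exprn_ge0.
apply: nearW => n; rewrite sumEFin lee_fin.
have := @geometric_seriesE R e z; rewrite lt_eqF// => /(_ isT)/(congr1 (@^~ n)).
rewrite /series/= => ->.
rewrite ler_wpM2r ?invr_ge0 ?subr_ge0 ?(ltW z1)//.
by rewrite ler_piMr// gerBl exprn_ge0.
Qed.

(** * Averages of the weight below an admissible exponent *)

Section admissible_weights.
Context {R : realType} {d : measure_display}
  {X : completeMetricMeasurableType R d} (mu : {measure set X -> \bar R}).
Variables (E : set X) (M a b : R).
Hypotheses (bm : @borel R d X `<=` measurable) (E0 : E !=set0)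
  (M1 : 1 <= M) (dM : doubling_with mu M)
  (hole_gt0 : forall x r, E x -> 0 < r -> 0 < hole E x r)
  (a0 : 0 <= a) (ab : a < b) (adm : muckenhoupt_admissible mu E b).
Implicit Types (x y z : X) (r s u : R).

Let W := dist_weight E a.
Let mW : measurable_fun [set: X] W := measurable_dist_weight bm E0 a.
Let W0 : forall x, (0 <= W x)%E := dist_weight_ge0 E a.

Let mball x r : measurable (ball x r : set X).
Proof. exact: measurable_ball. Qed.

Let mnbhd r : measurable (set_nbhd E r).
Proof. exact: measurable_set_nbhd. Qed.

Let pow2_gt0 k : 0 < (2 : R) ^+ k. Proof. by rewrite exprn_gt0. Qed.

Lemma admissible_dyadic : exists2 C : R, 0 < C & forall x r (k : nat),
  E x -> 0 < r ->
  (mu (set_nbhd E (hole E x r / 2 ^+ k) `&` ball x r) <=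
   (C * (2 ^+ k) `^ (- b))%:E * mu (ball x r))%E.
Proof.
have [C HC] := adm; exists (Num.max 1 C); first by rewrite lt_max ltr01.
move=> x r k Ex r0; have H0 := hole_gt0 Ex r0.
have [m0 moo _] := dM x r0.
(* For [k = 0] the scale equals the hole, which the strict range of admissibility excludes; there
   the constant is at least 1 and the bound is trivial. *)
case: k => [|k].
  rewrite expr0 powR1 mulr1.
  apply: (@le_trans _ _ (1%:E * mu (ball x r))%E).
    by rewrite mul1e le_measure ?inE//; exact: measurableI.
  by rewrite lee_wpmul2r// lee_fin le_max lexx.
have := HC x r (hole E x r / 2 ^+ k.+1) Ex r0.
rewrite divr_gt0// ltr_pdivrMr// ltr_pMr// exprn_egt1 ?ltr1n// => /(_ isT isT).
rewrite hole_le2r ?(ltW r0)// => /(_ isT).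
rewrite muleC lee_pinveMl// => /le_trans; apply.
rewrite lee_wpmul2r// lee_fin invf_div mulrCA divff ?gt_eqF// mulr1.
by rewrite ler_wpM2r ?powR_ge0// le_max lexx orbT.
Qed.

(** The coefficient bounds the weight on the layer between [H / 2 ^+ k.+1] and [H / 2 ^+ k]. The
    indicator is that of the whole neighbourhood, so the series diverges at distance 0, where the
    weight may be +oo. *)
Let f H (k : nat) y : \bar R :=
  (((H / 2 ^+ k.+1) `^ (- a)) * \1_(set_nbhd E (H / 2 ^+ k)) y)%:E.

Let f0 H k y : (0 <= f H k y)%E.
Proof. by rewrite lee_fin mulr_ge0 ?powR_ge0. Qed.

Lemma dist_weight_le_series H y : 0 < H ->
  (W y <= (H `^ (- a))%:E + \sum_(0 <= k <oo) f H k y)%E.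
Proof.
move=> H0; have S0 : (0 <= \sum_(0 <= k <oo) f H k y)%E by exact: nneseries_ge0.
have [yH|yH] := leP H (set_dist y E).
  by rewrite (le_trans (dist_weight_le a0 H0 yH))// leeDl.
suff h : (W y <= \sum_(0 <= k <oo) f H k y)%E.
  by rewrite (le_trans h)// leeDr// lee_fin powR_ge0.
have := set_dist_ge0 y E; rewrite le_eqVlt => /predU1P[y0|y0].
  suff -> : (\sum_(0 <= k <oo) f H k y = +oo)%E by rewrite leey.
  apply/eqyP => A A0.
  have p0 : 0 < (H / 2) `^ (- a) by rewrite powR_gt0// divr_gt0.
  pose n := (Num.truncn (A / (H / 2) `^ (- a))).+1.
  apply: (le_trans _ (nneseries_lim_ge n _)) => //.
  rewrite sumEFin lee_fin.
  apply: (@le_trans _ _ (\sum_(0 <= k < n) (H / 2) `^ (- a))).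
    rewrite sumr_const_nat subn0 -[leRHS]mulr_natl -ler_pdivrMr// ltW//.
    by rewrite truncnS_gt.
  apply: ler_sum => k _; rewrite indicE mem_set ?mulr1; last first.
    by rewrite /set_nbhd/= -y0 divr_gt0.
  apply: powR_antitone => //; first by rewrite divr_gt0.
  rewrite ler_pM2l// lef_pV2 ?posrE// -[leLHS]expr1.
  by rewrite ler_eXn2l ?ltr1n.
have [n nP nmin] : exists2 n, H / 2 ^+ n <= set_dist y E &
    forall m, H / 2 ^+ m <= set_dist y E -> (n <= m)%N.
  have ex : exists n, H / 2 ^+ n <= set_dist y E.
    pose n := (Num.truncn (H / set_dist y E)).+1; exists n.
    rewrite ler_pdivrMr// mulrC -ler_pdivrMr//.
    have : H / set_dist y E < n%:R by rewrite truncnS_gt.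
    move=> /ltW/le_trans; apply.
    by rewrite -natrX ler_nat ltnW// ltn_expl.
  by have [n ? ?] := ex_minnP ex; exists n.
case: n => [|n] in nP nmin.
  by move: nP; rewrite expr0 divr1 leNgt yH.
have yn : set_dist y E < H / 2 ^+ n.
  by rewrite ltNge; apply/negP => /nmin; rewrite ltnn.
apply: (@le_trans _ _ (f H n y)).
  rewrite /f indicE mem_set ?mulr1//.
  by apply: dist_weight_le => //; rewrite divr_gt0.
apply: (le_trans _ (nneseries_lim_ge n.+1 _)) => //.
by rewrite big_nat_recr//= leeDr// sume_ge0.
Qed.

Lemma admissible_integral : exists2 C : R, 0 <= C & forall x r,
  E x -> 0 < r ->
  (\int[mu]_(y in ball x r) W y <=
   (C * hole E x r `^ (- a))%:E * mu (ball x r))%E.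
Proof.
have [C C0 HC] := admissible_dyadic.
(* Ratio of the series: each layer multiplies the bound on the weight by 2^a and the bound on the
   measure by 2^(-b). *)
pose z : R := 2 `^ (a - b).
have z0 : 0 < z by rewrite powR_gt0.
have z1 : z < 1.
  rewrite /z /powR gt_eqF// expR_lt1 pmulr_llt0 ?subr_lt0//.
  by rewrite ln_gt0// ltr1n.
exists (1 + 2 `^ a * C / (1 - z)).
  by rewrite addr_ge0// divr_ge0 ?mulr_ge0 ?powR_ge0 ?(ltW C0)// subr_ge0 ltW.
move=> x r Ex r0; have H0 := hole_gt0 Ex r0; set H := hole E x r in H0 *.
have [m0 moo _] := dM x r0.
have mf k : measurable_fun (ball x r) (f H k).
  by apply/measurable_EFinP; apply: measurable_funM.
have mS : measurable_fun (ball x r) (fun y => \sum_(0 <= k <oo) f H k y)%E.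
  exact: ge0_emeasurable_sum.
apply: (@le_trans _ _ (\int[mu]_(y in ball x r)
   ((H `^ (- a))%:E + \sum_(0 <= k <oo) f H k y))%E).
  apply: ge0_le_integral => //.
  - exact: measurable_funTS.
  - exact: emeasurable_funD.
  - by move=> y _; exact: dist_weight_le_series.
rewrite ge0_integralD//; last 2 first.
  by move=> y _; rewrite lee_fin powR_ge0.
  by move=> y _; exact: nneseries_ge0.
rewrite integral_cst// integral_nneseries//.
rewrite mulrDl mul1r EFinD ge0_muleDl ?lee_fin ?powR_ge0//; last first.
  by rewrite !mulr_ge0 ?powR_ge0 ?invr_ge0 ?(ltW C0)// subr_ge0 ltW.
apply: leeD => //.
have mE : mu (ball x r) = (fine (mu (ball x r)))%:E by rewrite fineK// ge0_fin_numE.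
set m := fine _ in mE; have m_ge0 : 0 <= m by exact: fine_ge0.
rewrite mE -EFinM.
rewrite (_ : _ * m = 2 `^ a * C * H `^ (- a) * m / (1 - z)); last first.
  by field; rewrite subr_eq0 gt_eqF.
apply: le_trans (nneseries_geometric_le _ _); last 2 first.
- by rewrite !mulr_ge0 ?powR_ge0 ?(ltW C0).
- by rewrite (ltW z0).
apply: lee_nneseries => [k _ _|k _]; first exact: integral_ge0.
rewrite /f; under eq_integral do rewrite EFinM.
rewrite ge0_integralZl//; last 2 first.
- by apply/measurable_EFinP; apply: measurable_indic.
- by rewrite lee_fin powR_ge0.
rewrite integral_indic//.
apply: (@le_trans _ _ (((H / 2 ^+ k.+1) `^ (- a))%:E *
   ((C * (2 ^+ k) `^ (- b))%:E * mu (ball x r)))%E).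
  by apply: lee_wpmul2l; [rewrite lee_fin powR_ge0|exact: HC].
rewrite mE -!EFinM lee_fin.
have -> : (H / 2 ^+ k.+1) `^ (- a) = H `^ (- a) * (2 `^ a * (2 ^+ k) `^ a).
  rewrite powRM ?invr_ge0 ?exprn_ge0 ?(ltW H0)// powRV ?exprn_ge0// opprK exprS.
  by rewrite powRM ?exprn_ge0.
have -> : z ^+ k = (2 ^+ k) `^ a * (2 ^+ k) `^ (- b).
  have -> : z ^+ k = (2 ^+ k) `^ (a - b).
    by rewrite -(powR_mulrn _ (ltW z0)) /z powRAC powR_mulrn.
  by rewrite powRD// (gt_eqF (pow2_gt0 k)) implybT.
by rewrite le_eqVlt; apply/orP; left; apply/eqP; ring.
Qed.

(** If [2 * r <= set_dist x E], the weight is nearly constant on the ball. Otherwise the ball lies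
    in a comparable one centred on [E], where admissibility applies. The same [m] bounds the
    distance, hence [w] from below and the dual weight from above. *)
Lemma dist_weight_ball_bound : exists2 C : R, 0 <= C & forall x r, 0 < r ->
  exists m, [/\ 0 < m, forall y, ball x r y -> set_dist y E <= m &
    (\int[mu]_(y in ball x r) W y <=
     (C * m `^ (- a))%:E * mu (ball x r))%E].
Proof.
have M0 : 0 < M := lt_le_trans ltr01 M1.
have [C C0 HC] := admissible_integral.
(* The entries serve balls far from and near to [E]. In both cases [m] is 3 times the natural scale;
   [M ^+ 3] pays for the inclusion of the ball of radius [4 * r] at [x'] in that of radius [8 * r]
   at [x]. *)
exists (Num.max (3 `^ a) (C * 3 `^ a * M ^+ 3)).
  by rewrite le_max powR_ge0.
have pow3 v : 0 < v -> 3 `^ a * (3 * v) `^ (- a) = v `^ (- a).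
  move=> v0; rewrite powRM ?(ltW v0)// mulrA [3 `^ a * _]mulrC powRNK//.
  by rewrite mul1r.
move=> x r r0; have [far|near] := leP (2 * r) (set_dist x E).
  pose v := set_dist x E / 2.
  have v0 : 0 < v by rewrite divr_gt0//; apply: lt_le_trans far; rewrite mulr_gt0.
  have xE : set_dist x E = 2 * v by rewrite /v; field.
  exists (3 * v); split; first by rewrite mulr_gt0.
    move=> y; rewrite ballEmdist/= => xy.
    by have := set_dist_lip y x E0; rewrite metric_sym; lra.
  apply: (@le_trans _ _ ((v `^ (- a))%:E * mu (ball x r))%E).
    apply: integral_le_cst => //; first exact: measurable_funTS.
    move=> y; rewrite ballEmdist/= => xy; apply: dist_weight_le => //.
    by have := set_dist_lip x y E0; lra.
  rewrite lee_wpmul2r// lee_fin -pow3// ler_wpM2r ?powR_ge0//.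
  by rewrite le_max lexx.
have [x' Ex' xx'] := set_dist_lt E0 near.
have r40 : 0 < 4 * r by rewrite mulr_gt0.
pose h := hole E x' (4 * r); have h0 : 0 < h by exact: hole_gt0.
have sub2 : ball x (2 * r) `<=` ball x' (4 * r).
  by apply: subset_ball_triangle; rewrite metric_sym; lra.
exists (3 * h); split; first by rewrite mulr_gt0.
  move=> y; rewrite ballEmdist/= => xy.
  have y3 : set_dist y E <= 3 * r.
    rewrite (le_trans (set_dist_le y Ex'))//.
    by have := metric_triangle y x x'; rewrite (metric_sym y x); lra.
  (* The ball of radius [v] at [y] is a hole in the large ball, so [v <= h]; and the distance is at
     most [3 * v] because it is at most [3 * r]. *)
  pose v := Num.min (set_dist y E) r.
  have [yE|yE] := leP (set_dist y E) 0; first by rewrite (le_trans yE)// mulr_ge0 ?(ltW h0).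
  have v0 : 0 < v by rewrite lt_min yE.
  have vr : v <= r by rewrite ge_min lexx orbT.
  have vh : v <= h.
    apply: (@le_hole _ _ _ _ _ _ y); first by rewrite v0; lra.
    move=> w yw; split.
      by apply: sub2; apply: subset_ball_triangle yw; lra.
    by apply: (@ball_set_dist _ _ _ y v) => //; rewrite ge_min lexx.
  have : set_dist y E <= 3 * v.
    by rewrite /v; case: (leP (set_dist y E) r) => _; lra.
  lra.
have h1 : (\int[mu]_(y in ball x r) W y <= \int[mu]_(y in ball x' (4 * r)) W y)%E.
  apply: ge0_subset_integral => //; first exact: measurable_funTS.
  by move=> y xy; apply: sub2; apply: le_ball xy; lra.
have h2 : (mu (ball x' (4 * r)) <= (M ^+ 3)%:E * mu (ball x r))%E.
  apply: le_trans (doubling_iter 3 x dM (ltW M0) r0).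
  apply: le_measure; rewrite ?inE//.
  by apply: subset_ball_triangle; rewrite (_ : 2 ^+ 3 = 8 :> R); [lra|ring].
apply: (le_trans h1); apply: (le_trans (HC x' (4 * r) Ex' r40)); rewrite -/h.
apply: (@le_trans _ _ ((C * h `^ (- a))%:E * ((M ^+ 3)%:E * mu (ball x r)))%E).
  by apply: lee_wpmul2l => //; rewrite lee_fin mulr_ge0 ?powR_ge0.
rewrite muleA -EFinM lee_wpmul2r// lee_fin -(pow3 h)//.
rewrite [leLHS](_ : _ = C * 3 `^ a * M ^+ 3 * (3 * h) `^ (- a)); last by ring.
by rewrite ler_wpM2r ?powR_ge0// le_max lexx orbT.
Qed.

End admissible_weights.

(** * Characterization of A_1 and A_p through [Mu] *)

Section muckenhoupt_classes.
Context {R : realType} {d : measure_display}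
  {X : completeMetricMeasurableType R d} (mu : {measure set X -> \bar R}).
Variables (E : set X) (M D c t : R).
Hypotheses (bm : @borel R d X `<=` measurable) (E0 : E !=set0)
  (M1 : 1 <= M) (dM : doubling_with mu M)
  (D1 : 1 <= D)
  (dD : forall x r, 0 < r -> hole E x (2 * r) <= D * hole E x r)
  (c0 : 0 < c) (t01 : 0 < t <= 1 / 2) (pE : porous_with mu E c t).
Implicit Types (x y z : X) (r s u a b p : R).

Let mball x r : measurable (ball x r : set X).
Proof. exact: measurable_ball. Qed.

Let mW a A : measurable_fun A (dist_weight E a).
Proof. by apply: measurable_funTS; exact: measurable_dist_weight. Qed.

Let t0 : 0 < t. Proof. by case/andP: t01. Qed.

Let hole_gt0 x r : 0 < r -> 0 < hole E x r.
Proof. by move=> r0; have [] := pE x r0. Qed.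

Let mfar x r : measurable (far_part E t x r).
Proof. by apply: measurableI => //; exact: measurable_set_dist_ge. Qed.

Let mu_far_gt0 x r : 0 < r -> (0 < mu (far_part E t x r))%E.
Proof.
move=> r0; have [_] := pE x r0; apply: lt_le_trans.
by rewrite mule_gt0//; have [] := dM x r0.
Qed.

Lemma lt_MuP a :
  (a%:E < Mu mu E)%E <-> exists2 b, a < b & muckenhoupt_admissible mu E b.
Proof.
rewrite /Mu; case: asboolP => [_|]; last by case=> x r _; exact: hole_gt0.
split=> [/ereal_sup_gt[_ [b bE <-]]|[b ab bE]].
  by rewrite lte_fin => ab; exists b.
apply: (@lt_le_trans _ _ b%:E); first by rewrite lte_fin.
by apply: ereal_sup_ubound; exists b.
Qed.

Lemma weight_dist_weight a :
  (forall x r, 0 < r -> (\int[mu]_(y in ball x r) dist_weight E a y < +oo)%E) ->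
  weight mu (dist_weight E a).
Proof.
move=> Woo; split=> [x|x r r0]; first exact: dist_weight_ge0.
apply/integrableP; split => //; under eq_integral do rewrite gee0_abs ?dist_weight_ge0//.
exact: Woo.
Qed.

Lemma average_ge0 a x r : (0 <= average mu (dist_weight E a) (ball x r))%E.
Proof.
rewrite mule_ge0// ?inve_ge0//; apply: integral_ge0 => y _.
exact: dist_weight_ge0.
Qed.

Lemma average_le a x r (K : R) : 0 < r ->
  (average mu (dist_weight E a) (ball x r) <= K%:E)%E =
  (\int[mu]_(y in ball x r) dist_weight E a y <= K%:E * mu (ball x r))%E.
Proof. by move=> r0; have [? ? _] := dM x r0; rewrite /average lee_pinveMl. Qed.

Lemma average_le_cst a x r (K : R) : 0 < r ->
  (forall y, ball x r y -> (dist_weight E a y <= K%:E)%E) ->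
  (average mu (dist_weight E a) (ball x r) <= K%:E)%E.
Proof.
move=> r0 WK; rewrite average_le//; apply: integral_le_cst => // y _.
exact: dist_weight_ge0.
Qed.

(** Keep only the integral over the far part, which carries the proportion [c] of the measure. *)
Lemma average_distN_ge b x r : 0 <= b -> 0 < r ->
  ((c * (t * hole E x r) `^ b)%:E <=
   average mu (dist_weight E (- b)) (ball x r))%E.
Proof.
move=> b0 r0; have [m0 moo _] := dM x r0; have [_ far] := pE x r0.
rewrite /average lee_pinveMr//.
apply: (@le_trans _ _ (((t * hole E x r) `^ b)%:E * mu (far_part E t x r))%E).
  rewrite mulrC EFinM -muleA lee_wpmul2l// lee_fin powR_ge0//.
apply: (@le_trans _ _ (\int[mu]_(y in far_part E t x r) dist_weight E (- b) y)%E).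
  apply: cst_le_integral => //; first exact: powR_ge0.
  move=> y [_ /= yt]; rewrite dist_weightN// lee_fin.
  apply: ge0_ler_powR => //; rewrite nnegrE ?set_dist_ge0//.
  by rewrite mulr_ge0 ?hole_ge0 ?(ltW t0).
apply: ge0_subset_integral => //; first by move=> y _; exact: dist_weight_ge0.
by move=> y [].
Qed.

Lemma ess_inf_on_le (w : X -> \bar R) (B G : set X) (v : \bar R) :
  measurable G -> (0 < mu G)%E -> G `<=` B -> (forall y, G y -> (w y <= v)%E) ->
  (ess_inf_on mu w B <= v)%E.
Proof.
move=> mG G0 GB wv; rewrite leNgt; apply/negP => vw.
have [N [mN N0 wN]] := ess_inf_le mu (patch (cst +oo%E) B w).
move: G0; apply/negP; rewrite -leNgt -N0; apply: le_measure; rewrite ?inE//.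
move=> y Gy; apply: wN => /=; rewrite /patch mem_set; last exact: GB.
by move=> /(lt_le_trans vw); rewrite ltNge wv.
Qed.

Lemma le_ess_inf_on (w : X -> \bar R) (B : set X) (v : \bar R) :
  (forall y, B y -> (v <= w y)%E) -> (v <= ess_inf_on mu w B)%E.
Proof.
move=> vw; apply/ess_infP; apply: aeW => y; rewrite /patch.
by case: ifPn => [/set_mem/vw//|_]; rewrite leey.
Qed.

Lemma average_bound_lt_Mu a (K : R) : 0 <= a -> 0 <= K ->
  (forall x r, 0 < r -> (average mu (dist_weight E a) (ball x r) <=
     (K * hole E x r `^ (- a))%:E)%E) ->
  (a%:E < Mu mu E)%E.
Proof.
move=> a0 K0 aK; apply/lt_MuP.
apply: (muckenhoupt_self_improvement bm E0 M1 dM D1 dD c0 t01 pE a0 K0).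
by move=> x r r0; rewrite -average_le//; exact: aK.
Qed.

Lemma Mu_gt0 : (0 < Mu mu E)%E.
Proof.
apply: (@average_bound_lt_Mu 0 1) => // x r r0.
rewrite oppr0 powRr0 mulr1; apply: average_le_cst => // y _.
by rewrite dist_weight0.
Qed.

Lemma A1_of_lt_Mu a : 0 <= a -> (a%:E < Mu mu E)%E -> A1 mu (dist_weight E a).
Proof.
move=> a0 /lt_MuP[b ab adm].
have [C C0 HC] := dist_weight_ball_bound bm E0 M1 dM
  (fun x r _ => @hole_gt0 x r) a0 ab adm.
split.
  apply: weight_dist_weight => x r r0; have [m [_ _ /le_lt_trans]] := HC x r r0.
  apply; have [_ moo _] := dM x r0.
  by rewrite lte_mul_pinfty// lee_fin mulr_ge0 ?powR_ge0.
exists C => // x r r0; have [m [m0 ym Wm]] := HC x r r0.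
move: Wm; rewrite -average_le// => /le_trans; apply; rewrite EFinM.
rewrite lee_wpmul2l//; apply: le_ess_inf_on => y /ym.
exact: le_dist_weight.
Qed.

(** For [a >= 0] the far part, of positive measure, bounds the essential infimum, so [a] is good.
    For [a < 0] the weight tends to 0 at a point of [E], so its essential infimum near that point is
    0 while its average is positive. *)
Lemma lt_Mu_of_A1 a : A1 mu (dist_weight E a) -> 0 <= a /\ (a%:E < Mu mu E)%E.
Proof.
move=> [_ [C C0 HC]]; have [a0|a0] := leP 0 a.
  split => //; apply: (@average_bound_lt_Mu _ (C * t `^ (- a))) => //.
    by rewrite mulr_ge0 ?powR_ge0.
  move=> x r r0; apply: (le_trans (HC x r r0)).
  rewrite -mulrA -powRM ?hole_ge0 ?(ltW t0)// EFinM lee_wpmul2l//.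
  apply: (@ess_inf_on_le _ _ (far_part E t x r)) => //.
  - exact: mu_far_gt0.
  - by move=> y [].
  - move=> y [_ yt]; apply: dist_weight_le => //.
    by rewrite mulr_gt0// hole_gt0.
exfalso; have [e Ee] := E0.
have b0 : 0 < - a by rewrite oppr_gt0.
pose A := c * (t * hole E e 1) `^ (- a).
have A0 : 0 < A by rewrite mulr_gt0// powR_gt0// mulr_gt0// hole_gt0.
have lb : (A%:E <= average mu (dist_weight E a) (ball e 1))%E.
  by have := @average_distN_ge (- a) e 1 (ltW b0) ltr01; rewrite opprK.
(* Small enough that [C * k < A]; [u] is the distance at which the weight equals [k]. *)
pose k := A / (2 * (C + 1)).
have C1 : 0 < C + 1 by rewrite ltr_wpDl.
have k0 : 0 < k by rewrite divr_gt0// mulr_gt0.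
pose u := k `^ (- a)^-1.
have u0 : 0 < u by rewrite powR_gt0.
have uk : u `^ (- a) = k by rewrite /u -powRrM mulVf ?gt_eqF// powRr1// ltW.
pose v := Num.min u 1.
have v0 : 0 < v by rewrite lt_min u0 ltr01.
have inf_le : (ess_inf_on mu (dist_weight E a) (ball e 1) <= k%:E)%E.
  apply: (@ess_inf_on_le _ _ (ball e v)) => //.
  - by have [] := dM e v0.
  - by apply: le_ball; rewrite ge_min lexx orbT.
  - move=> y; rewrite ballEmdist/= => ey.
    rewrite -(opprK a) dist_weightN ?(ltW b0)// lee_fin -uk.
    apply: ge0_ler_powR; rewrite ?nnegrE ?set_dist_ge0 ?(ltW b0) ?(ltW u0)//.
    rewrite (le_trans (set_dist_le y Ee))// metric_sym (le_trans (ltW ey))//.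
    by rewrite ge_min lexx.
have : (A%:E <= (C * k)%:E)%E.
  rewrite (le_trans lb)// (le_trans (HC e 1 ltr01))// EFinM.
  by rewrite lee_wpmul2l.
rewrite lee_fin leNgt => /negP; apply.
have Ak : A = 2 * (C + 1) * k by rewrite /k; field; rewrite gt_eqF.
by rewrite Ak ltr_pM2r//; lra.
Qed.

Lemma Ap_of_average_le p a (K : R) : 1 < p ->
  (forall x r, 0 < r -> exists A B, [/\ 0 <= A, 0 <= B,
     A * B `^ (p - 1) <= K,
     (average mu (dist_weight E a) (ball x r) <= A%:E)%E &
     (average mu (dist_weight E (a / (1 - p))) (ball x r) <= B%:E)%E]) ->
  Ap mu p (dist_weight E a).
Proof.
move=> p1 AB; split.
  apply: weight_dist_weight => x r r0; have [A [B [A0 _ _ + _]]] := AB x r r0.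
  rewrite average_le// => /le_lt_trans; apply; have [_ moo _] := dM x r0.
  by rewrite lte_mul_pinfty// lee_fin.
apply: (@le_lt_trans _ _ K%:E); last exact: ltry.
apply: ge_ereal_sup => _ [[x r] /= r0 <-].
have [A [B [A0 B0 ABK hA hB]]] := AB x r r0.
rewrite epow_dist_weight; last by rewrite div1r invr_lt0 subr_lt0.
rewrite div1r; apply: (@le_trans _ _ (A%:E * (B `^ (p - 1))%:E)%E).
  apply: lee_pmul => //; [exact: average_ge0|exact: poweR_ge0|].
  rewrite -poweR_EFin; apply: gt0_ler_poweR => //; rewrite ?subr_ge0 ?(ltW p1)//.
    by rewrite in_itv/= average_ge0 leey.
  by rewrite in_itv/= lee_fin B0 leey.
by rewrite -EFinM lee_fin.
Qed.

Lemma average_le_of_Ap p a : 1 < p -> Ap mu p (dist_weight E a) ->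
  exists2 K : R, 0 <= K & forall x r, 0 < r ->
    (average mu (dist_weight E a) (ball x r) *
     average mu (dist_weight E (a / (1 - p))) (ball x r) `^ (p - 1) <= K%:E)%E.
Proof.
move=> p1 [_]; set S := [set _ | _ in _] => Soo.
(* The maximum with 0 makes the supremum, known to be below +oo, a finite nonnegative number. *)
exists (fine (Order.max 0%E (ereal_sup S))).
  by rewrite fine_ge0// le_max lexx.
move=> x r r0; rewrite fineK; last first.
  rewrite ge0_fin_numE; last by rewrite le_max lexx.
  by rewrite gt_max Soo ltry.
rewrite le_max; apply/orP; right; apply: ereal_sup_ubound.
exists (x, r) => //=; rewrite epow_dist_weight ?div1r//.
by rewrite invr_lt0 subr_lt0.
Qed.

(** One of [a] and [a / (1 - p)] is nonnegative: its weight has averages controlled by a negative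
    power of [m], the other weight is bounded pointwise by a power of [m], and the powers cancel in
    the product. *)
Lemma Ap_of_lt_Mu p a : 1 < p -> (a%:E < Mu mu E)%E ->
  ((a / (1 - p))%:E < Mu mu E)%E -> Ap mu p (dist_weight E a).
Proof.
move=> p1 aMu a'Mu; have p10 : 0 < p - 1 by rewrite subr_gt0.
have le_pow b m y : 0 <= b -> 0 < m -> set_dist y E <= m ->
    (dist_weight E (- b) y <= (m `^ b)%:E)%E.
  move=> b0 m0 ym; rewrite dist_weightN// lee_fin.
  by apply: ge0_ler_powR; rewrite ?nnegrE ?set_dist_ge0 ?(ltW m0).
have [a0|a0] := leP 0 a.
  have /lt_MuP[b ab adm] := aMu.
  have [C C0 HC] := dist_weight_ball_bound bm E0 M1 dM
    (fun x r _ => @hole_gt0 x r) a0 ab adm.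
  apply: (@Ap_of_average_le _ _ C) => // x r r0.
  have [m [m0 ym Wm]] := HC x r r0.
  exists (C * m `^ (- a)), (m `^ (a / (p - 1))); split.
  - by rewrite mulr_ge0 ?powR_ge0.
  - exact: powR_ge0.
  - by rewrite -powRrM divfK ?gt_eqF// -mulrA powRNK// mulr1.
  - by rewrite average_le.
  - apply: average_le_cst => // y /ym yE.
    rewrite (_ : a / (1 - p) = - (a / (p - 1))); last first.
      by rewrite -opprB invrN mulrN.
    by apply: le_pow => //; rewrite divr_ge0 ?(ltW p10).
have a'0 : 0 <= a / (1 - p).
  by rewrite mulr_le0 ?invr_le0 ?(ltW a0)// subr_le0 ltW.
have /lt_MuP[b ab adm] := a'Mu.
have [C C0 HC] := dist_weight_ball_bound bm E0 M1 dM
  (fun x r _ => @hole_gt0 x r) a'0 ab adm.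
apply: (@Ap_of_average_le _ _ (C `^ (p - 1))) => // x r r0.
have [m [m0 ym Wm]] := HC x r r0.
exists (m `^ (- a)), (C * m `^ (- (a / (1 - p)))); split.
- exact: powR_ge0.
- by rewrite mulr_ge0 ?powR_ge0.
- rewrite powRM ?powR_ge0// -powRrM.
  rewrite (_ : - (a / (1 - p)) * (p - 1) = a); last first.
    by field; rewrite subr_eq0 lt_eqF.
  by rewrite mulrCA (powRNK a m0) mulr1.
- apply: average_le_cst => // y /ym yE.
  by have := le_pow (- a) m y; rewrite opprK; apply; rewrite ?oppr_ge0 ?(ltW a0).
- by rewrite average_le.
Qed.

Lemma poweR_le_inv (x : \bar R) (y r : R) : 0 < r -> (0 <= x)%E ->
  (x `^ r <= y%:E)%E -> (x <= (y `^ r^-1)%:E)%E.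
Proof.
move=> r0; case: x => [x| |//]; last by rewrite poweRyr ?gt_eqF.
rewrite poweR_EFin !lee_fin => x0 xy.
rewrite -[x]powRr1// -(mulfV (lt0r_neq0 r0)) powRrM.
apply: ge0_ler_powR => //; rewrite ?invr_ge0 ?nnegrE ?powR_ge0 ?(ltW r0)//.
exact: le_trans (powR_ge0 _ _) xy.
Qed.

(** Of the two exponents, one is at most 0 and lies below [Mu] by [Mu_gt0]. Its weight is a
    nonnegative power of the distance, with averages bounded below by porosity; dividing the A_p
    bound by them makes the other exponent good. *)
Lemma lt_Mu_of_Ap p a : 1 < p -> Ap mu p (dist_weight E a) ->
  ((a / (1 - p))%:E < Mu mu E)%E /\ (a%:E < Mu mu E)%E.
Proof.
move=> p1 /(average_le_of_Ap p1)[K K0 HK]; have p10 : 0 < p - 1 by rewrite subr_gt0.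
have p10' : 1 - p < 0 by rewrite subr_lt0.
have th0 x r : 0 < r -> 0 < t * hole E x r by move=> r0; rewrite mulr_gt0// hole_gt0.
have [a0|a0] := leP 0 a.
  split.
    apply: le_lt_trans Mu_gt0.
    by rewrite lee_fin mulr_ge0_le0// invr_le0 ltW.
  pose b := a / (p - 1); have b0 : 0 <= b by rewrite divr_ge0// ltW.
  have bE : a / (1 - p) = - b by rewrite /b -opprB invrN mulrN.
  apply: (@average_bound_lt_Mu _ (K * c `^ (1 - p) * t `^ (- a))) => //.
    by rewrite !mulr_ge0 ?powR_ge0.
  move=> x r r0; set h := hole E x r.
  have lb := average_distN_ge x b0 r0; rewrite -bE in lb.
  have q0 : 0 < (c * (t * h) `^ b) `^ (p - 1).
    by rewrite powR_gt0// mulr_gt0// powR_gt0// th0.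
  rewrite (_ : _ * _ * _ = K / (c * (t * h) `^ b) `^ (p - 1)); last first.
    rewrite powRM ?powR_ge0 ?(ltW c0)// -powRrM divfK ?gt_eqF//.
    rewrite invfM -!powRN opprB -2!mulrA; congr (_ * (_ * _)).
    by rewrite powRM ?hole_ge0 ?(ltW t0).
  rewrite EFinM lee_pdivlMr//; apply: le_trans (HK x r r0).
  apply: lee_wpmul2l; first exact: average_ge0.
  rewrite -poweR_EFin; apply: gt0_ler_poweR => //; rewrite ?(ltW p10)//.
    by rewrite in_itv/= lee_fin mulr_ge0 ?powR_ge0 ?(ltW c0)// leey.
  by rewrite in_itv/= average_ge0 leey.
split; last by apply: lt_trans Mu_gt0; rewrite lte_fin.
have a'0 : 0 <= a / (1 - p) by rewrite mulr_le0 ?invr_le0 ?(ltW a0) ?(ltW p10').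
apply: (@average_bound_lt_Mu _ ((K / c) `^ (p - 1)^-1 * t `^ (- (a / (1 - p))))) => //.
  by rewrite mulr_ge0 ?powR_ge0.
move=> x r r0; set h := hole E x r.
have na0 : 0 <= - a by rewrite oppr_ge0 ltW.
have lb := average_distN_ge x na0 r0; rewrite opprK -/h in lb.
have q0 : 0 < c * (t * h) `^ (- a) by rewrite mulr_gt0// powR_gt0// th0.
have : (average mu (dist_weight E (a / (1 - p))) (ball x r) `^ (p - 1) <=
    (K / (c * (t * h) `^ (- a)))%:E)%E.
  rewrite EFinM lee_pdivlMr// muleC; apply: le_trans (HK x r r0).
  by apply: lee_wpmul2r => //; exact: poweR_ge0.
move=> /(poweR_le_inv p10 (average_ge0 _ _ _))/le_trans; apply.
rewrite lee_fin invfM mulrA -powRN opprK.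
have Kc0 : 0 <= K / c by rewrite divr_ge0// ltW.
rewrite (powRM _ Kc0 (powR_ge0 _ _)) -powRrM.
rewrite (_ : a * (p - 1)^-1 = - (a / (1 - p))); last first.
  by rewrite -opprB invrN mulrN.
by rewrite -(mulrA _ (t `^ _)) -(powRM _ (ltW t0) (hole_ge0 _ _ _)).
Qed.

End muckenhoupt_classes.

Unset Implicit Arguments.

Theorem theorem9p5 (R : realType) (d : measure_display)
  (X : completeMetricMeasurableType R d) (mu : {measure set X -> \bar R})
  (mu_borel_regular : borel_regular mu) (mu_complete : measure_is_complete mu)
  (mu_doubling : doubling_measure mu)
  (E : set X) (E_nonempty : E !=set0)
  (E_weakly_porous : weakly_porous mu E) (hole_doubling : doubling_hole E)
  (alpha : R) :
  (A1 mu (dist_weight E alpha) <-> 0 <= alpha /\ (alpha%:E < Mu mu E)%E) /\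
  (forall p : R, 1 < p ->
    (Ap mu p (dist_weight E alpha) <->
     ((1 - p)%:E * Mu mu E < alpha%:E)%E /\ (alpha%:E < Mu mu E)%E)).
Proof.
have [bm _] := mu_borel_regular.
have [M M1 dM] := doubling_measureW mu_doubling.
have [c [t [c0 t01 pE]]] := weakly_porousW bm E_nonempty dM M1 E_weakly_porous.
have [D' _ dD'] := hole_doubling; pose D := Num.max 1 D'.
have D1 : 1 <= D by rewrite le_max lexx.
have dD x r : 0 < r -> hole E x (2 * r) <= D * hole E x r.
  move=> r0; rewrite (le_trans (dD' x r r0))// ler_wpM2r ?hole_ge0//.
  by rewrite le_max lexx orbT.
split.
  split=> [|[a0 aMu]].
    exact: (lt_Mu_of_A1 bm E_nonempty M1 dM D1 dD c0 t01 pE).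
  exact: (A1_of_lt_Mu bm E_nonempty M1 dM pE).
(* Dividing by the negative number [1 - p] reverses the inequality: the lower bound on [alpha] is
   the upper bound on the dual exponent. *)
move=> p p1; have dualE : ((1 - p)%:E * Mu mu E < alpha%:E)%E =
    ((alpha / (1 - p))%:E < Mu mu E)%E.
  by rewrite -lte_ndivrMl ?subr_lt0// -EFinM mulrC.
rewrite dualE; split=> [|[a'Mu aMu]].
  exact: (lt_Mu_of_Ap bm E_nonempty M1 dM D1 dD c0 t01 pE).
exact: (Ap_of_lt_Mu bm E_nonempty M1 dM pE).
Qed.
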